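(* Let $G$ be a finite cyclic group whose order is either a prime power or a product of two distinct primes greater than $3$, and let $\mathcal{I}$ be a $G$-indexing system. Then $\mathcal{I}$ is the class of admissible sets of the linear isometries operad $\mathcal{L}(U)$ for some $G$-universe $U$ if and only if $\mathcal{I}$ satisfies the condition: for all subgroups $K\subset L\subset H\subset G$, if $H/K\in\mathcal{I}(H)$, then $L/K\in\mathcal{I}(L)$ and $H/L\in\mathcal{I}(H)$.
   Context: Let $G$ be a finite group. A $G$-indexing system $\mathcal{I}$ assigns to each subgroup $H\subset G$ a class $\mathcal{I}(H)$ of finite $H$-sets such that: (1) $\mathcal{I}(H)$ contains all finite trivial $H$-sets; (2) $\mathcal{I}(H)$ is closed under isomorphism; (3) if $K\subset H$ and $T\in\mathcal{I}(H)$ then $\mathrm{res}^H_K T\in\mathcal{I}(K)$; (4) if $g\in G$ and $T\in\mathcal{I}(H)$ then the conjugate $gHg^{-1}$-set $c_gT$ lies in $\mathcal{I}(gHg^{-1})$; (5) $\mathcal{I}(H)$ is closed under passage to sub-$H$-sets; (6) $\mathcal{I}(H)$ is closed under binary coproducts; (7) if $K\subset H$, $T\in\mathcal{I}(K)$ and $H/K\in\mathcal{I}(H)$, then $\mathrm{ind}_K^H T\in\mathcal{I}(H)$. A $G$-universe is a countably infinite dimensional real inner product space $U$ with a linear isometric $G$-action, which contains each of its (finite dimensional) subrepresentations infinitely often, and which contains trivial summands. The linear isometries operad $\mathcal{L}(U)$ has $n$-th level $\mathcal{L}(U)(n)$ the $G\times\Sigma_n$-space of all linear, not necessarily equivariant,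 isometries $U^{\oplus n}\hookrightarrow U$ ($G$ acts by conjugation, $\Sigma_n$ by permuting summands). For $H\subset G$ and a finite $H$-set $T$, let $\Gamma(T)\subset G\times\Sigma_{|T|}$ be the graph $\{(h,\sigma(h))\mid h\in H\}$ of a permutation representation $\sigma:H\to\Sigma_{|T|}$ of $T$. The $H$-set $T$ is admissible for $\mathcal{L}(U)$ if $\mathcal{L}(U)(|T|)^{\Gamma(T)}\neq\varnothing$. The class of all admissible sets of $\mathcal{L}(U)$ is a $G$-indexing system. By a known theorem of Blumberg and Hill, an orbit $H/K$ is admissible for $\mathcal{L}(U)$ iff there is an $H$-equivariant linear embedding $\mathrm{ind}_K^H\mathrm{res}^G_K U\hookrightarrow \mathrm{res}^G_H U$. *)

(* Defs.v *)
From HB Require Import structures.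
From mathcomp Require Import all_boot all_order all_fingroup all_algebra cyclic.
From mathcomp Require Import reals.

Set Implicit Arguments.
Unset Strict Implicit.
Unset Printing Implicit Defensive.

Import GRing.Theory Num.Theory.

(* MathComp actions are right actions, and this is the convention throughout:
   a left H-set (or left G-representation) is the right one given by
   t . h = h^-1 t.  In particular the orbit H/K is the set of right cosets of K
   in H.  For to : action H T the values of to^~ h with h outside H carry no
   information.  The ambient group G is the whole type gT. *)

Section FiniteHSets.
Local Open Scope group_scope.

Variable gT : finGroupType.
Implicit Types (K H : {group gT}) (T : finType) (g h x : gT).

Definition hset_iso H T1 T2 (to1 : action H T1) (to2 : action H T2) : Prop :=
  exists f : T1 -> T2,
    bijective f /\ {in H, forall h t, f (to1 t h) = to2 (f t) h}.

Definition trivial_hset H T (to : action H T) : Prop :=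
  {in H, forall h t, to t h = t}.

(* In left-action terms an element x of gHg^-1 acts on c_g T as g^-1 x g, which
   is x ^ g; note that gHg^-1 is H :^ g^-1 in MathComp. *)
Lemma conj_is_action H T (to : action H T) g :
  is_action (H :^ g^-1) (fun t x => to t (x ^ g)).
Proof.
split=> [x|t x y]; first exact: act_inj.
by rewrite !mem_conjgV => Hx Hy; rewrite conjMg actMin.
Qed.

Definition conj_act H T (to : action H T) g : action (H :^ g^-1)%G T :=
  Action (conj_is_action to g).

Lemma sub_act_dom H T (to : action H T) (S : {set T}) :
  [acts H, on S | to] -> H \subset subact_dom [eta mem S] to.
Proof.
move=> nS; rewrite /subact_dom.
by rewrite (_ : [set t | _] = S) //; apply/setP => t; rewrite inE.
Qed.

Definition sub_act H T (to : action H T) (S : {set T})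
    (nS : [acts H, on S | to]) : action H {t : T | t \in S} :=
  ((subaction {t : T | t \in S} to) \ (sub_act_dom nS))%act.

Lemma sum_is_action H T1 T2 (to1 : action H T1) (to2 : action H T2) :
  is_action H (fun (t : T1 + T2) h =>
    match t with inl t1 => inl (to1 t1 h) | inr t2 => inr (to2 t2 h) end).
Proof.
split=> [h [t|t] [u|u] //= []|[t|t] h k Hh Hk]; rewrite ?actMin //.
- by move/act_inj->.
- by move/act_inj->.
Qed.

Definition sum_act H T1 T2 (to1 : action H T1) (to2 : action H T2) :
    action H (T1 + T2)%type :=
  Action (sum_is_action to1 to2).

Lemma coset_acts H K : [acts H, on rcosets K H | ('Rs \ subsetT H)%act].
Proof.
apply/subsetP=> h Hh; rewrite !inE Hh /=.
apply/subsetP=> _ /rcosetsP[x Hx ->].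
rewrite inE /= rcosetE -rcosetM.
by apply/rcosetsP; exists (x * h) => //; rewrite groupM.
Qed.

(* H/K, for K a subgroup of H *)
Definition coset_act H K : action H {X : {set gT} | X \in rcosets K H} :=
  sub_act (coset_acts H K).

(* Induction: ind_K^H T = T x_K H is the set of classes of pairs (t, x), x in H,
   for the relation (t k, x) ~ (t, k x) with k in K, that is the set of orbits
   of the K-action (t, x) . k = (t k, k^-1 x); H acts by right multiplication
   on the second component. *)
Lemma balance_is_action K T (to : action K T) :
  is_action K (fun (tx : T * gT) k => (to tx.1 k, k^-1 * tx.2)).
Proof.
split=> [k [t x] [u y] [/act_inj-> /mulgI->] //|[t x] k l Kk Kl /=].
by rewrite actMin // invMg mulgA.
Qed.

Definition balance_act K T (to : action K T) : action K (T * gT)%type :=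
  Action (balance_is_action to).

Definition ind_carrier K H T (to : action K T) : {set {set T * gT}} :=
  [set orbit (balance_act to) K tx | tx in setX [set: T] H].

Lemma rtransl_is_action T :
  is_action [set: gT] (fun (tx : T * gT) h => (tx.1, tx.2 * h)).
Proof.
split=> [h [t x] [u y] [-> /mulIg->] //|[t x] h k _ _ /=].
by rewrite mulgA.
Qed.

Definition rtransl_act T : {action gT &-> (T * gT)%type} :=
  Action (rtransl_is_action T).

Lemma ind_acts K H T (to : action K T) :
  [acts H, on ind_carrier H to | ((rtransl_act T)^* \ subsetT H)%act].
Proof.
have E h t x : (rtransl_act T)^*%act (orbit (balance_act to) K (t, x)) h
             = orbit (balance_act to) K (t, x * h).
  rewrite /= /setact /orbit -imset_comp.
  by apply: eq_imset => k /=; rewrite mulgA.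
apply/subsetP=> h Hh; rewrite !inE Hh /=.
apply/subsetP=> _ /imsetP[[t x] /setXP[_ Hx] ->].
rewrite inE [X in X \in _](E h t x); apply/imsetP.
by exists (t, x * h) => //; rewrite !inE groupM.
Qed.

Definition ind_act K H T (to : action K T) :
    action H {X : {set T * gT} | X \in ind_carrier H to} :=
  sub_act (ind_acts H to).

Definition hset_class : Type :=
  forall (H : {group gT}) (T : finType), action H T -> Prop.

Record indexing_system (I : hset_class) : Prop := IndexingSystem {
  indexing_trivial : forall H T (to : action H T), trivial_hset to -> I H T to;
  indexing_iso : forall H T1 T2 (to1 : action H T1) (to2 : action H T2),
    hset_iso to1 to2 -> I H T1 to1 -> I H T2 to2;
  indexing_res : forall K H T (to : action H T) (sKH : K \subset H),
    I H T to -> I K T (to \ sKH)%act;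
  indexing_conj : forall H T (to : action H T) g,
    I H T to -> I (H :^ g^-1)%G T (conj_act to g);
  indexing_sub : forall H T (to : action H T) (S : {set T})
      (nS : [acts H, on S | to]),
    I H T to -> I H {t : T | t \in S} (sub_act nS);
  indexing_sum : forall H T1 T2 (to1 : action H T1) (to2 : action H T2),
    I H T1 to1 -> I H T2 to2 -> I H (T1 + T2)%type (sum_act to1 to2);
  indexing_ind : forall K H T (to : action K T),
    K \subset H -> I K T to -> I H _ (coset_act H K) ->
    I H _ (ind_act H to)
}.

End FiniteHSets.

Section Universes.
Local Open Scope ring_scope.

Variables (R : realType) (gT : finGroupType).

(* algebraic (Hamel) dimension *)
Definition countably_infinite_dim (U : lmodType R) : Prop :=
  exists e : nat -> U,
    (forall n (c : 'I_n -> R),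
       \sum_(i < n) c i *: e i = 0 -> forall i, c i = 0) /\
    (forall u, exists n (c : 'I_n -> R), u = \sum_(i < n) c i *: e i).

Definition fin_dim_subspace (U : lmodType R) (V : U -> Prop) : Prop :=
  exists n (b : 'I_n -> U),
    forall u, V u <-> exists c : 'I_n -> R, u = \sum_(i < n) c i *: b i.

Section Representations.
Variables (U : lmodType R) (dot : {dot U for idfun}) (rho : {action gT &-> U}).

Definition fin_dim_subrep (V : U -> Prop) : Prop :=
  fin_dim_subspace V /\ (forall u g, V u -> V (rho u g)).

(* U contains an orthogonal direct sum of countably many copies of V. *)
Definition contains_infinitely_often (V : U -> Prop) : Prop :=
  exists f : nat -> U -> U,
    [/\ forall n a u v, V u -> V v -> f n (a *: u + v) = a *: f n u + f n v,
        forall n u g, V u -> f n (rho u g) = rho (f n u) g,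
        forall n u v, V u -> V v -> dot (f n u) (f n v) = dot u v
      & forall m n u v, m != n -> V u -> V v -> dot (f m u) (f n v) = 0].

End Representations.

Record universe := Universe {
  universe_space :> lmodType R;
  universe_dot : {dot universe_space for idfun};
  universe_act : {action gT &-> universe_space};
  universe_dim : countably_infinite_dim universe_space;
  universe_linear : forall g, linear (universe_act^~ g);
  universe_isometric : forall u v g,
    universe_dot (universe_act u g) (universe_act v g) = universe_dot u v;
  universe_rep : forall V, fin_dim_subrep universe_act V ->
    contains_infinitely_often universe_dot universe_act V;
  universe_trivial : exists2 u : universe_space,
    u != 0 & forall g, universe_act u g = u
}.

Variable U : universe.
Local Notation dot := (universe_dot U).
Local Notation rho := (universe_act U).

(* the n-th level L(U)(n) of the linear isometries operad *)
Definition lin_isom n (f : {ffun 'I_n -> U} -> U) : Prop :=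
  linear f /\ forall u v, dot (f u) (f v) = \sum_(i < n) dot (u i) (v i).

(* The action of G x Sigma_n on L(U)(n): G by conjugation, Sigma_n by permuting
   the summands.  Products in 'S_n are composed left to right, so that this is
   again a right action. *)
Definition operad_act n (f : {ffun 'I_n -> U} -> U) (x : gT * 'S_n) :
    {ffun 'I_n -> U} -> U :=
  fun u => rho (f [ffun i => rho (u (x.2 i)) x.1^-1%g]) x.1.

Section Admissible.
Variables (H : {group gT}) (T : finType) (to : action H T).

Lemma perm_rep_inj h :
  injective (fun i : 'I_#|T| => enum_rank (to (enum_val i) h)).
Proof. by move=> i j /enum_rank_inj/act_inj/enum_val_inj. Qed.

Definition perm_rep h : 'S_#|T| := perm (@perm_rep_inj h).

Definition graph_subgroup : {set gT * 'S_#|T|} := [set (h, perm_rep h) | h in H].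

Definition admissible : Prop :=
  exists f : {ffun 'I_#|T| -> U} -> U,
    lin_isom f /\ {in graph_subgroup, forall x, operad_act f x =1 f}.

End Admissible.
End Universes.

(* Main.v *)
From HB Require Import structures.
Require Import Defs.
From mathcomp Require Import all_boot all_order all_fingroup all_algebra cyclic.
From mathcomp Require Import separable cyclotomic.
From mathcomp Require Import boolp reals.
From mathcomp Require Import complex.
From mathcomp Require Import ring zify.

Set Implicit Arguments.
Unset Strict Implicit.
Unset Printing Implicit Defensive.

Import Order.TTheory GRing.Theory Num.Theory.

(** Why the theorem holds.

  Both sides of the equality between I and the admissible sets are decided by
  orbits, so everything is about the relation K -> H, meaning H/K in I(H).

  Necessity holds for every finite group.  L/K is an orbit of the restriction
  of H/K to L.  For H/L, an H-equivariant isometry out of the space of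
  U-valued functions on H/K can be precomposed with the pullback of functions
  along H/K -> H/L, which is isometric up to a scalar
  (admissible_coset_overgroup).

  For sufficiency the universe is built from its weights.  A faithful
  character w of the cyclic group G gives characters w^x for x an integer, and
  for a set S of integers containing 0 and stable under negation, U_S is the
  orthogonal sum of infinitely many copies of each character w^a, a in S, seen
  as a real representation; its carrier is the space of complex polynomials
  with G acting on each coefficient by a scalar.  Fourier analysis shows that
  an H-set is admissible for U_S if and only if for every stabilizer K of one
  of its points, every integer congruent mod |K| to an element of S is
  congruent mod |H| to an element of S (weight_admissible): the characters of
  H occurring in the functions on H/K with values in U_S are those whose
  restriction to K occurs in U_S.

  It remains to realize a given saturated relation K -> H by a set S.  Since
  subgroups of G correspond to divisors of |G|, and saturation and
  transitivity reduce the relation to pairs whose index is prime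
  (saturated_transfer_agree), only finitely many edges d -> d l must be
  matched.  When |G| = p^n, they form a chain and S is
  made of 0 and of the integers of valuation i, for the edges
  p^i -> p^(i+1) in the relation (prime_power_weights).  When |G| = pq, the
  edges form a square and there are seven saturated relations, realized by
  0 alone, by the multiples of p, of q, of p or q, by all integers, and by the
  multiples of q (or of p) together with 1 and -1 (two_primes_weights).  In the
  last case {0, 1, -1} must not be all of Z/q (or Z/p), which is why p and q
  have to exceed 3. *)

(** * Orbits and indexing systems *)

Section Orbits.
Local Open Scope group_scope.
Variable gT : finGroupType.
Implicit Types (K L H : {group gT}) (T : finType).

Lemma val_sub_act H T (to : action H T) (S : {set T})
    (nS : [acts H, on S | to]) (u : {t : T | t \in S}) h :
  h \in H -> val (sub_act nS u h) = to (val u) h.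
Proof.
move=> Hh; rewrite /sub_act /= val_subact.
by rewrite (subsetP (sub_act_dom nS)).
Qed.

Lemma orbit_acts H T (to : action H T) t : [acts H, on orbit to H t | to].
Proof. exact: acts_orbit. Qed.

Lemma in_stab H T (to : action H T) t h :
  (h \in 'C_H[t | to]) = (h \in H) && (to t h == t).
Proof. by rewrite !inE; case: (h \in H); rewrite //= sub1set inE. Qed.

(** The orbit of t is identified with H/K by sending a coset to the image of t
    under its canonical representative; this lemma makes that independent of
    the representative. *)
Lemma act_rcoset_repr H T (to : action H T) t x :
  x \in H -> to t (repr ('C_H[t | to] :* x)) = to t x.
Proof.
move=> Hx; have /rcosetP[y] := mem_repr_rcoset 'C_H[t | to]%G x.
by rewrite in_stab => /andP[Hy /eqP ty] ->; rewrite actMin // ty.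
Qed.

Lemma transporter_rcoset H T (to : action H T) t x :
  x \in H -> [set h in H | to t h == to t x] = 'C_H[t | to] :* x.
Proof.
move=> Hx; apply/setP=> h; rewrite inE mem_rcoset in_stab.
have [Hh|nHh] := boolP (h \in H); last first.
  by rewrite groupMr ?groupV //= (negPf nHh).
rewrite groupM ?groupV //= actMin ?groupV // -[in RHS](inj_eq (act_inj to x)).
by rewrite -!actMin ?groupM ?groupV // -?mulgA mulVg mulg1.
Qed.

(** The orbit-stabilizer theorem, as an isomorphism of H-sets. *)
Lemma coset_orbit_iso H T (to : action H T) t
    (nO : [acts H, on orbit to H t | to]) :
  hset_iso (coset_act H 'C_H[t | to]%G) (sub_act nO).
Proof.
have rH (X : {X : {set gT} | X \in rcosets 'C_H[t | to] H}) : repr (val X) \in H.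
  case: X => _ /= /rcosetsP[x Hx ->].
  have /rcosetP[y /setIP[Hy _] ->] := mem_repr_rcoset 'C_H[t | to]%G x.
  by rewrite groupM.
have Of (X : {X : {set gT} | X \in rcosets 'C_H[t | to] H}) :
  to t (repr (val X)) \in orbit to H t by apply: mem_orbit; exact: rH X.
pose f X : {u | u \in orbit to H t} := exist _ (to t (repr (val X))) (Of X).
have fE X : val (f X) = to t (repr (val X)) by [].
have Og (u : {u | u \in orbit to H t}) :
  [set h in H | to t h == val u] \in rcosets 'C_H[t | to] H.
  case: u => _ /= /orbitP[x Hx <-]; apply/rcosetsP; exists x => //.
  exact: transporter_rcoset.
pose g u := exist (fun X : {set gT} => X \in rcosets 'C_H[t | to] H) _ (Og u).
exists f; split.
  exists g => [X|u]; apply: val_inj => /=.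
    case: X (fE X) => _ /= /rcosetsP[x Hx ->] _.
    by rewrite act_rcoset_repr // transporter_rcoset.
  have /rcosetsP[x Hx gE] := Og u.
  have: repr [set h in H | to t h == val u] \in [set h in H | to t h == val u].
    by rewrite gE mem_repr_rcoset.
  by rewrite inE => /andP[_ /eqP].
move=> h Hh X; apply: val_inj; rewrite val_sub_act // !fE val_sub_act //.
case: X => _ /= /rcosetsP[x Hx ->].
rewrite rcosetE -rcosetM !act_rcoset_repr ?groupM //.
by rewrite actMin.
Qed.

Section Indexing.
Variable I : hset_class gT.
Hypothesis I_ok : indexing_system I.

(** An indexing system is determined by the orbits it contains, because it is
    closed under disjoint unions and under invariant subsets. *)
Lemma indexing_orbits H T (to : action H T) :
  I to <-> forall t, I (coset_act H 'C_H[t | to]%G).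
Proof.
split=> [IT t|IO].
  have [f [[g fK gK] fE]] := coset_orbit_iso (orbit_acts to t).
  apply: (indexing_iso I_ok _ (indexing_sub I_ok (orbit_acts to t) IT)).
  exists g; split; first by exists f.
  by move=> h Hh u; rewrite -{1}(gK u) -fE // fK.
(* induction on the size of an invariant subset of the fixed H-set T, splitting
   off one orbit at a time *)
suff sub_ok n : forall (S : {set T}) (nS : [acts H, on S | to]),
    #|S| <= n -> I (sub_act nS).
  have nT : [acts H, on [set: T] | to].
    by apply/subsetP=> h Hh; rewrite !inE Hh; apply/subsetP=> t _; rewrite !inE.
  apply: (indexing_iso I_ok _ (sub_ok _ _ nT (leqnn _))).
  exists val; split.
    exists (fun t => exist _ t (in_setT t)) => [u|//].
    exact: val_inj.
  by move=> h Hh u; rewrite val_sub_act.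
elim: n => [|n IHn] S nS.
  rewrite leqn0 cards_eq0 => /eqP S0; apply: (indexing_trivial I_ok).
  by move=> h _ [u Su]; exfalso; rewrite S0 inE in Su.
move=> leS; have [S0|[t St]] := set_0Vmem S.
  by apply: IHn; rewrite S0 cards0.
have sOS : orbit to H t \subset S by rewrite acts_sub_orbit.
have nSO : [acts H, on S :\: orbit to H t | to].
  by apply: (subset_trans _ (astabsD _ _ _)); rewrite subsetI nS orbit_acts.
have IS1 : I (sub_act (orbit_acts to t)).
  exact: (indexing_iso I_ok (coset_orbit_iso (orbit_acts to t))).
have IS2 : I (sub_act nSO).
  apply: IHn; rewrite -ltnS (leq_trans _ leS) //; apply: proper_card.
  rewrite properE subsetDl; apply/subsetPn; exists t => //.
  by rewrite !inE orbit_refl.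
apply: (indexing_iso I_ok _ (indexing_sum I_ok IS1 IS2)).
have Sl (u : {u | u \in orbit to H t}) : val u \in S.
  exact: (subsetP sOS) (valP u).
have Sr (u : {u | u \in S :\: orbit to H t}) : val u \in S.
  by case: u => u /= /setDP[].
pose f w : {u | u \in S} := match w with
  | inl u => exist (fun t => t \in S) (val u) (Sl u)
  | inr u => exist (fun t => t \in S) (val u) (Sr u)
  end.
exists f; split; last first.
  by move=> h Hh [] u; apply: val_inj; rewrite val_sub_act //; exact: val_sub_act.
apply: inj_card_bij => [[] u [] v /(congr1 val) /= uv|].
- by congr inl; apply: val_inj.
- by case: v uv => v /= Sv uv; exfalso; case/setDP: Sv => _; rewrite -uv (valP u).
- by case: u uv => u /= Su uv; exfalso; case/setDP: Su => _; rewrite uv (valP v).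
- by congr inr; apply: val_inj.
rewrite card_sum !card_sig -(cardsID (orbit to H t) S) (setIidPr sOS).
by rewrite leq_add // subset_leq_card //; apply/subsetP => x.
Qed.

Lemma val_coset_act K H (X : {X : {set gT} | X \in rcosets K H}) h :
  h \in H -> val (coset_act H K X h) = val X :* h.
Proof. by move=> Hh; rewrite val_sub_act //= rcosetE. Qed.

Lemma val_ind_act K H T (to : action K T) t x h
    (X : {X : {set T * gT} | X \in ind_carrier H to}) :
  val X = orbit (balance_act to) K (t, x) -> h \in H ->
  val (ind_act H to X h) = orbit (balance_act to) K (t, x * h).
Proof.
move=> XE Hh; rewrite val_sub_act //= XE /setact /orbit -imset_comp.
by apply: eq_imset => k /=; rewrite mulgA.
Qed.

Lemma coset1_in K H : (K : {set gT}) \in rcosets K H.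
Proof. by apply/rcosetsP; exists 1; rewrite ?group1 ?mulg1 ?rcoset1. Qed.

Definition coset1 K H : {X : {set gT} | X \in rcosets K H} :=
  exist (fun X : {set gT} => X \in rcosets K H) _ (coset1_in K H).

(** The stabilizer in L of the coset K is L :&: K, so this orbit occurs in the
    restriction of H/K to L. *)
Lemma indexing_restr K L H : L \subset H ->
  I (coset_act H K) -> I (coset_act L (L :&: K)%G).
Proof.
move=> sLH /(indexing_res I_ok sLH)/indexing_orbits.
move/(_ (coset1 K H)).
set K1 := 'C_L[_ | _]%G; suff -> : K1 = (L :&: K)%G by [].
apply/val_inj/setP=> h; rewrite in_stab inE.
have [Lh|//] := boolP (h \in L).
rewrite -val_eqE [X in X == _](val_coset_act (coset1 K H)) ?(subsetP sLH) //=.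
by apply/eqP/idP => [<-|Kh]; [exact: rcoset_refl | exact: rcoset_id].
Qed.

(** H/K is isomorphic to the set induced from L/K; it is enough that K is the
    stabilizer of the class of (K, 1) in it. *)
Lemma indexing_trans K L H : K \subset L -> L \subset H ->
  I (coset_act L K) -> I (coset_act H L) -> I (coset_act H K).
Proof.
move=> sKL sLH IK IL.
have := indexing_ind I_ok sLH IK IL; move/indexing_orbits.
pose t0 := coset1 K L.
have c0 : orbit (balance_act (coset_act L K)) L (t0, 1)
           \in ind_carrier H (coset_act L K).
  by apply/imsetP; exists (t0, 1); rewrite // !inE group1.
move/(_ (exist (fun X => X \in ind_carrier H (coset_act L K)) _ c0)).
set K1 := 'C_H[_ | _]%G; suff -> : K1 = K by [].
apply/val_inj/setP=> h; rewrite in_stab.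
have [Hh|nHh] := boolP (h \in H); last first.
  by apply/esym/negbTE; apply: contra nHh => Kh; rewrite (subsetP sLH) ?(subsetP sKL).
rewrite -val_eqE [X in X == _](val_ind_act (to := coset_act L K) (t := t0) (x := 1)) //= mul1g.
rewrite (sameP eqP (orbit_in_eqP (subxx L))).
apply/orbitP/idP => [[k Lk /= []]|Kh].
  move/(congr1 val); rewrite val_coset_act //= => Kk kh.
  have: k \in K by rewrite -Kk rcoset_refl.
  by rewrite -kh mulg1 groupV.
exists h^-1; first by rewrite groupV (subsetP sKL).
congr pair; last by rewrite invgK mulg1.
apply: val_inj; rewrite val_coset_act ?groupV ?(subsetP sKL) //=.
by rewrite rcoset_id ?groupV.
Qed.

Lemma indexing_refl H : I (coset_act H H).
Proof.
apply: (indexing_trivial I_ok) => h Hh X; apply: val_inj.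
rewrite val_coset_act //.
by case: X => _ /= /rcosetsP[x Hx ->]; rewrite -rcosetM !rcoset_id ?groupM.
Qed.

End Indexing.
End Orbits.

(** * Admissible sets of a general universe *)

Section Admissibility.
Local Open Scope ring_scope.
Variables (R : realType) (gT : finGroupType) (U : universe R gT).
Local Notation dot := (universe_dot U).
Local Notation rho := (universe_act U).
Implicit Types (K L H : {group gT}) (T : finType).

Lemma rhoM u g h : rho u (g * h)%g = rho (rho u g) h.
Proof. by case: rho => to /= [_ toM]; apply: toM; rewrite inE. Qed.

Lemma rho1 u : rho u 1%g = u.
Proof.
have rho_inj : left_injective rho by case: rho => to /= [].
by apply: (rho_inj 1%g); rewrite -rhoM mulg1.
Qed.

Lemma rhoK u h : rho (rho u h) h^-1%g = u.
Proof. by rewrite -rhoM mulgV rho1. Qed.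

Lemma rhoVK u h : rho (rho u h^-1%g) h = u.
Proof. by rewrite -rhoM mulVg rho1. Qed.

Lemma rhoZ a u h : rho (a *: u) h = a *: rho u h.
Proof.
have r0 : rho 0 h = 0.
  have := @universe_linear _ _ U h 1 0 0; rewrite !(scaler0, scale1r, addr0) => l0.
  by apply: (addrI (rho 0 h)); rewrite addr0 -l0.
by have := @universe_linear _ _ U h a u 0; rewrite !addr0 => ->; rewrite r0 addr0.
Qed.

(** Indexing the summands by T itself turns a fixed point of the graph subgroup
    into an H-equivariant isometry from the space of U-valued functions on T,
    that is, from the representation induced along T, to U. *)
Lemma admissibleP H T (to : action H T) :
  admissible U to <-> exists f : {ffun T -> U} -> U,
    [/\ linear f,
        forall u v, dot (f u) (f v) = \sum_t dot (u t) (v t)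
      & forall h (u : {ffun T -> U}), h \in H ->
          f [ffun t => rho (u (to t h)) h^-1%g] = rho (f u) h^-1%g].
Proof.
split=> [[f [[f_lin f_iso] f_fix]]|[f [f_lin f_iso f_fix]]].
  pose F (u : {ffun T -> U}) := f [ffun i => u (enum_val i)].
  exists F; split=> [a u v|u v|h u Hh].
  - rewrite /F -f_lin; congr f; apply/ffunP=> i; by rewrite !ffunE.
  - rewrite f_iso [RHS](reindex_onto enum_val enum_rank) /=; last first.
      by move=> t _; rewrite enum_rankK.
    apply: eq_big => [i|i _]; last by rewrite !ffunE.
    by rewrite enum_valK eqxx.
  - have /f_fix/(_ [ffun i => u (enum_val i)]) : (h, perm_rep to h) \in graph_subgroup to.
      exact: imset_f.
    rewrite /operad_act /= /F => <-; rewrite rhoK; congr f.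
    by apply/ffunP=> i; rewrite !ffunE permE enum_rankK.
pose F (v : {ffun 'I_#|T| -> U}) := f [ffun t => v (enum_rank t)].
exists F; split; first split.
- by move=> a u v; rewrite /F -f_lin; congr f; apply/ffunP=> i; rewrite !ffunE.
- move=> u v; rewrite f_iso [LHS](reindex_onto enum_val enum_rank) /=; last first.
    by move=> t _; rewrite enum_rankK.
  by apply: eq_big => i; rewrite ?enum_valK ?eqxx // => _; rewrite !ffunE enum_valK.
move=> _ /imsetP[h Hh ->] v; rewrite /operad_act /=.
rewrite -[RHS](rhoVK _ h) /F -f_fix //; congr (rho (f _) h).
apply/ffunP=> t; rewrite !ffunE; congr (rho (v _) _).
by rewrite permE enum_rankK.
Qed.

Lemma sum_rcosets K H (F : {set gT} -> R) : K \subset H ->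
  \sum_(h in H) F (K :* h)%g =
    #|K|%:R * \sum_(X : {X : {set gT} | X \in rcosets K H}) F (val X).
Proof.
move=> sKH; rewrite mulr_sumr.
have -> : \sum_(X : {X : {set gT} | X \in rcosets K H}) #|K|%:R * F (val X) =
          \sum_(X in rcosets K H) #|K|%:R * F X.
  by rewrite (big_sub (mem (rcosets K H)) (fun X => #|K|%:R * F X)).
rewrite (partition_big (rcoset K) (mem (rcosets K H))) /=; last first.
  by move=> h Hh; apply/rcosetsP; exists h; rewrite ?rcosetE.
apply: eq_bigr => _ /rcosetsP[x Hx ->]; rewrite -(card_rcoset K x) mulr_natl.
rewrite -sumr_const; apply: eq_big => [h|h /andP[_ /eqP <-]]; last by rewrite rcosetE.
rewrite !rcosetE (sameP eqP rcoset_eqP) andb_idl //.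
by case/rcosetP=> k Kk ->; rewrite groupM // (subsetP sKH).
Qed.

(** Pulling back along H/K -> H/L turns functions on H/L into functions on H/K
    and multiplies norms by the square root of the index of K in L; the factor
    c below compensates for this. *)
Lemma admissible_coset_overgroup K L H : K \subset L -> L \subset H ->
  admissible U (coset_act H K) -> admissible U (coset_act H L).
Proof.
move=> sKL sLH /admissibleP[f [f_lin f_iso f_fix]]; apply/admissibleP.
have pE h : (L * (K :* h) = L :* h)%g by rewrite mulgA mulGSid.
have pP (X : {X : {set gT} | X \in rcosets K H}) : (L * val X)%g \in rcosets L H.
  case: X => _ /= /rcosetsP[x Hx ->]; rewrite pE.
  by apply/rcosetsP; exists x.
pose p X := exist (fun Y => Y \in rcosets L H) _ (pP X).
pose c : R := #|K|%:R / #|L|%:R.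
have c_ge0 : 0 <= c by rewrite divr_ge0.
have K0 : #|K|%:R != 0 :> R by rewrite pnatr_eq0 -lt0n cardG_gt0.
have L0 : #|L|%:R != 0 :> R by rewrite pnatr_eq0 -lt0n cardG_gt0.
pose q (u : {ffun {Y : {set gT} | Y \in rcosets L H} -> U}) := [ffun X => u (p X)].
exists (fun u => Num.sqrt c *: f (q u)); split=> [a u v|u v|h u Hh].
- rewrite scalerA [a * _]mulrC -scalerA -scalerDr -f_lin; congr (_ *: f _).
  by apply/ffunP=> X; rewrite !ffunE.
- rewrite linearZl_LR linearZr_LR /= f_iso mulrA -expr2 sqr_sqrtr //.
  pose F Y := \sum_(Z : {Z : {set gT} | Z \in rcosets L H} | val Z == Y) dot (u Z) (v Z).
  have FE Z : F (val Z) = dot (u Z) (v Z).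
    rewrite /F (big_pred1 Z) // => Z'; exact: val_eqE.
  transitivity (c * \sum_(X : {X : {set gT} | X \in rcosets K H}) F (L * val X)%g).
    by congr (c * _); apply: eq_bigr => X _; rewrite !ffunE -(FE (p X)).
  have e : #|K|%:R * \sum_(X : {X : {set gT} | X \in rcosets K H}) F (L * val X)%g
         = #|L|%:R * \sum_(Y : {Y : {set gT} | Y \in rcosets L H}) F (val Y).
    apply: etrans (esym (sum_rcosets (fun X => F (L * X)%g) (subset_trans sKL sLH))) _.
    by apply: etrans _ (sum_rcosets F sLH); apply: eq_bigr => h _; rewrite pE.
  rewrite /c mulrAC e mulrAC mulfV // mul1r.
  by apply: eq_bigr => Y _; rewrite FE.
- rewrite rhoZ -f_fix //; congr (_ *: f _); apply/ffunP=> X; rewrite !ffunE.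
  congr (rho (u _) _); apply: val_inj; rewrite val_coset_act //= val_coset_act //.
  by rewrite mulgA.
Qed.

End Admissibility.

(** * Faithful characters of cyclic groups *)

Section FaithfulCharacter.
Local Open Scope ring_scope.

Lemma prim_root_exists (F : closedFieldType) n :
  n%:R != 0 :> F -> exists z : F, n.-primitive_root z.
Proof.
move=> n0; have n_gt0 : (0 < n)%N by case: n n0 => //; rewrite eqxx.
have [r Dr] := closed_field_poly_normal ('X^n - 1 : {poly F}).
move: Dr; rewrite (monicP (monicXnsubC 1 n_gt0)) scale1r => Dr.
have ur : uniq r by rewrite -separable_prod_XsubC -Dr separable_Xn_sub_1.
have nr : (n <= size r)%N by rewrite -ltnS -(size_prod_XsubC r id) -Dr size_XnsubC.
have rn : all n.-unity_root r by apply/allP=> z; rewrite -root_prod_XsubC -Dr.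
by have /hasP[z _] := has_prim_root n_gt0 rn ur nr; exists z.
Qed.

Variable R : rcfType.

Lemma faithful_character (gT : finGroupType) : cyclic [set: gT] ->
  exists w : gT -> R[i]%C,
    [/\ w 1%g = 1, {morph w : x y / (x * y)%g >-> x * y} & injective w].
Proof.
case/cyclicP=> c Gc; have [|z zP] := @prim_root_exists R[i]%C #[c]%g.
  by rewrite pnatr_eq0 -lt0n order_gt0.
have log_ex g : exists m, g == (c ^+ m)%g.
  have /cycleP[m ->] : g \in <[c]>%g by rewrite -Gc inE.
  by exists m.
pose log g := ex_minn (log_ex g).
have logE g : g = (c ^+ log g)%g by rewrite /log; case: ex_minnP => m /eqP.
have zE m n : (z ^+ m == z ^+ n) = (c ^+ m == c ^+ n)%g.
  by rewrite (eq_prim_root_expr zP) -eq_expg_mod_order.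
exists (fun g => z ^+ log g); split=> [|x y|x y /eqP].
- by apply/eqP; rewrite -(expr0 z) zE -logE expg0.
- by rewrite -exprD; apply/eqP; rewrite zE expgD -!logE.
- by rewrite zE -!logE => /eqP.
Qed.

End FaithfulCharacter.

(** * The complex polynomials as a Hermitian space *)

Section Hermitian.
Local Open Scope ring_scope.
Variable R : rcfType.
Local Notation C := R[i]%C.
Implicit Types p q r : {poly C}.

(** The Hermitian form for which the monomials are an orthonormal basis. *)
Definition hdot p q : C := \sum_(i < size p) p`_i * (q`_i)^*.

Lemma hdotE M p q : (size p <= M)%N -> hdot p q = \sum_(i < M) p`_i * (q`_i)^*.
Proof.
move=> leM; rewrite /hdot (big_ord_widen_cond M xpredT (fun i => p`_i * (q`_i)^*)) //.
rewrite big_mkcond /=; apply: eq_bigr => i _; case: ltnP => // /(nth_default 0) ->.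
by rewrite mul0r.
Qed.

Lemma hdotDl p q r : hdot (p + q) r = hdot p r + hdot q r.
Proof.
pose M := maxn (size p) (size q).
have leM : (size (p + q)%R <= M)%N := size_polyD p q.
rewrite !(hdotE (M := M)) ?leq_maxl ?leq_maxr // -big_split.
by apply: eq_bigr => i _; rewrite coefD mulrDl.
Qed.

Lemma hdotC p q : hdot p q = (hdot q p)^*.
Proof.
pose M := maxn (size p) (size q).
rewrite !(hdotE (M := M)) ?leq_maxl ?leq_maxr // rmorph_sum.
by apply: eq_bigr => i _; rewrite rmorphM /= conjCK mulrC.
Qed.

Lemma hdotZl a p q : hdot (a *: p) q = a * hdot p q.
Proof.
rewrite (hdotE q (size_scale_leq a p)) mulr_sumr.
by apply: eq_bigr => i _; rewrite coefZ mulrA.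
Qed.

Lemma hdotDr p q r : hdot p (q + r) = hdot p q + hdot p r.
Proof. by rewrite hdotC hdotDl rmorphD /= -!hdotC. Qed.

Lemma hdotZr a p q : hdot p (a *: q) = a^* * hdot p q.
Proof. by rewrite hdotC hdotZl rmorphM /= -hdotC. Qed.

Lemma hdot0l p : hdot 0 p = 0.
Proof. by rewrite -(scale0r (0 : {poly C})) hdotZl mul0r. Qed.

Lemma hdot0r p : hdot p 0 = 0.
Proof. by rewrite hdotC hdot0l rmorph0. Qed.

Lemma hdot_suml (J : Type) (s : seq J) P (F : J -> {poly C}) p :
  hdot (\sum_(j <- s | P j) F j) p = \sum_(j <- s | P j) hdot (F j) p.
Proof. by apply: (big_morph (hdot^~ p)); [move=> q r; exact: hdotDl | exact: hdot0l]. Qed.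

Lemma hdot_sumr (J : Type) (s : seq J) P (F : J -> {poly C}) p :
  hdot p (\sum_(j <- s | P j) F j) = \sum_(j <- s | P j) hdot p (F j).
Proof. by apply: (big_morph (hdot p)); [move=> q r; exact: hdotDr | exact: hdot0r]. Qed.

Lemma hdotXn m n : hdot 'X^m 'X^n = (m == n)%:R.
Proof.
rewrite /hdot size_polyXn (bigD1 ord_max) //= !coefXn eqxx mul1r rmorph_nat.
rewrite big1 ?addr0 // => i; rewrite -val_eqE /= coefXn => /negPf->.
by rewrite mul0r.
Qed.

Lemma hdot_self_gt0 p : p != 0 -> 0 < complex.Re (hdot p p).
Proof.
move=> p0; rewrite -ltcR; have -> : (complex.Re (hdot p p))%:C%C = hdot p p.
  apply: RRe_real; rewrite /hdot; apply: ger0_real; apply: sumr_ge0 => i _.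
  exact: mul_conjC_ge0.
rewrite /hdot lt_neqAle eq_sym.
have ge0 (i : 'I_(size p)) : true -> 0 <= p`_i * (p`_i)^* by rewrite mul_conjC_ge0.
rewrite sumr_ge0 // andbT psumr_eq0 // -has_predC; apply/hasP.
have ltp : ((size p).-1 < size p)%N by rewrite prednK // lt0n size_poly_eq0.
exists (Ordinal ltp); first by rewrite mem_index_enum.
by rewrite /= mulf_eq0 conjC_eq0 orbb -lead_coefE lead_coef_eq0.
Qed.

(** An injection phi gives an isometric embedding of the space into itself, and
    injections with disjoint images give embeddings with orthogonal images. *)
Definition reindex_poly (phi : nat -> nat) p := \sum_(i < size p) p`_i *: 'X^(phi i).

Lemma reindex_polyE phi M p : (size p <= M)%N ->
  reindex_poly phi p = \sum_(i < M) p`_i *: 'X^(phi i).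
Proof.
move=> leM; rewrite /reindex_poly (big_ord_widen_cond M xpredT (fun i => p`_i *: 'X^(phi i))) //.
rewrite big_mkcond /=; apply: eq_bigr => i _; case: ltnP => // /(nth_default 0) ->.
by rewrite scale0r.
Qed.

Lemma reindex_polyP phi : linear (reindex_poly phi).
Proof.
move=> a p q; pose M := maxn (size p) (size q).
have leM : (size (a *: p + q)%R <= M)%N.
  by rewrite (leq_trans (size_polyD _ _)) // geq_max leq_max size_scale_leq leq_maxr.
rewrite !(@reindex_polyE _ M) ?leq_maxl ?leq_maxr // scaler_sumr -big_split.
by apply: eq_bigr => i _; rewrite coefD coefZ scalerDl scalerA.
Qed.

Lemma reindex_poly0 phi : reindex_poly phi 0 = 0.
Proof. by rewrite /reindex_poly size_poly0 big_ord0. Qed.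

Lemma reindex_polyZ phi a p : reindex_poly phi (a *: p) = a *: reindex_poly phi p.
Proof. by rewrite -[a *: p]addr0 reindex_polyP reindex_poly0 addr0. Qed.

Lemma hdot_reindex phi p q : injective phi ->
  hdot (reindex_poly phi p) (reindex_poly phi q) = hdot p q.
Proof.
move=> phi_inj; pose M := maxn (size p) (size q).
rewrite !(@reindex_polyE _ M) ?[RHS](hdotE (M := M)) ?leq_maxl ?leq_maxr //.
rewrite hdot_suml; apply: eq_bigr => i _; rewrite hdot_sumr (bigD1 i) //=.
rewrite hdotZl hdotZr hdotXn eqxx mulr1 big1 ?addr0 // => j ji.
rewrite hdotZl hdotZr hdotXn (inj_eq phi_inj) eq_sym (inj_eq val_inj) (negPf ji).
by rewrite !mulr0.
Qed.

Lemma hdot_reindex_disjoint phi psi p q : (forall m n, phi m != psi n) ->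
  hdot (reindex_poly phi p) (reindex_poly psi q) = 0.
Proof.
move=> disj; rewrite hdot_suml big1 // => i _; rewrite hdot_sumr big1 // => j _.
by rewrite hdotZl hdotZr hdotXn (negPf (disj _ _)) !mulr0.
Qed.

End Hermitian.

(** * The underlying real inner product space *)

(** A separate name, as the complex polynomials already carry a module structure
    over the complex numbers. *)
Definition cpoly (R : rcfType) : Type := {poly R[i]%C}.

Section RealStructure.
Local Open Scope ring_scope.
Variable R : rcfType.
HB.instance Definition _ := GRing.Zmodule.copy (cpoly R) {poly R[i]%C}.

Definition rscale (a : R) (p : cpoly R) : cpoly R := a%:C%C *: (p : {poly R[i]%C}).

Fact rscaleA a b p : rscale a (rscale b p) = rscale (a * b) p.
Proof. by rewrite /rscale rmorphM scalerA. Qed.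
Fact rscale1 : left_id 1 rscale.
Proof. by move=> p; rewrite /rscale scale1r. Qed.
Fact rscaleDr : right_distributive rscale +%R.
Proof. by move=> a p q; rewrite /rscale scalerDr. Qed.
Fact rscaleDl p : {morph rscale^~ p : a b / a + b}.
Proof. by move=> a b; rewrite /rscale rmorphD scalerDl. Qed.

HB.instance Definition _ := GRing.Zmodule_isLmodule.Build R (cpoly R)
  rscaleA rscale1 rscaleDr rscaleDl.

Definition rdot (p q : cpoly R) : R := complex.Re (hdot p q).

Fact ReD (x y : R[i]%C) : complex.Re (x + y) = complex.Re x + complex.Re y.
Proof. by case: x y => a b [c d]. Qed.
Fact ImD (x y : R[i]%C) : complex.Im (x + y) = complex.Im x + complex.Im y.
Proof. by case: x y => a b [c d]. Qed.
Fact ReZ (a : R) (x : R[i]%C) : complex.Re (a%:C%C * x) = a * complex.Re x.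
Proof. by case: x => b c /=; rewrite mul0r subr0. Qed.
Fact ImZ (a : R) (x : R[i]%C) : complex.Im (a%:C%C * x) = a * complex.Im x.
Proof. by case: x => b c /=; rewrite mul0r addr0. Qed.

Fact hdot_rscalel (a : R) (p q : cpoly R) : hdot (a *: p) q = a%:C%C * hdot p q.
Proof. exact: hdotZl. Qed.
Fact hdot_rscaler (a : R) (p q : cpoly R) : hdot p (a *: q) = a%:C%C * hdot p q.
Proof. by apply: etrans (hdotZr _ _ _) _; congr (_ * _); exact: conjc_real. Qed.

Fact rdot_bilinear : bilinear_for *%R (idfun \; *%R) rdot.
Proof.
split=> r a p q; rewrite /rdot.
  by rewrite hdotDl hdot_rscalel ReD ReZ.
by rewrite hdotDr hdot_rscaler ReD ReZ.
Qed.

HB.instance Definition _ :=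
  bilinear_isBilinear.Build R (cpoly R) (cpoly R) R *%R (idfun \; *%R) rdot rdot_bilinear.

Fact rdot_sym (p q : cpoly R) : rdot p q = (-1) ^+ false * idfun (rdot q p).
Proof. by rewrite expr0 mul1r /rdot hdotC; case: (hdot q p). Qed.

HB.instance Definition _ :=
  isHermitianSesquilinear.Build R (cpoly R) false idfun rdot rdot_sym.

Fact rdot_gt0 (p : cpoly R) : p != 0 -> 0 < rdot p p.
Proof. exact: hdot_self_gt0. Qed.

HB.instance Definition _ := isDotProduct.Build R (cpoly R) rdot rdot_gt0.

End RealStructure.

Section CountableDimension.
Local Open Scope ring_scope.

Lemma cpoly_countable_dim (R : realType) : countably_infinite_dim (cpoly R).
Proof.
(* the real basis 1, i, X, iX, X^2, iX^2, ... *)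
pose e k : cpoly R := (if odd k then 'i%C else 1) *: ('X^(k./2) : {poly R[i]%C}).
have ReE m k : complex.Re (e k)`_m = (k == m.*2)%:R.
  rewrite coefZ coefXn -[in RHS](odd_double_half k); case: (odd k) => /=.
    rewrite (_ : (true + _ == _)%N = false); last first.
      by apply/negP=> /eqP/(congr1 odd); rewrite oddD !odd_double.
    by case: eqP => _; rewrite ?mulr0 ?mulr1.
  by rewrite add0n (inj_eq double_inj) eq_sym mul1r; case: eqP.
have ImE m k : complex.Im (e k)`_m = (k == m.*2.+1)%:R.
  rewrite coefZ coefXn -[in RHS](odd_double_half k); case: (odd k) => /=.
    by rewrite add1n eqSS (inj_eq double_inj) eq_sym; case: eqP => _;
       rewrite ?mulr0 ?mulr1.
  rewrite add0n (_ : (_.*2 == _)%N = false); last first.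
    by apply/negP=> /eqP/(congr1 odd); rewrite /= !odd_double.
  by rewrite mul1r; case: eqP.
have RecE n (c : 'I_n -> R) m :
    complex.Re (\sum_(i < n) c i *: e i : cpoly R)`_m = \sum_(i < n) c i * (val i == m.*2)%:R.
  have -> : (\sum_(i < n) c i *: e i : cpoly R)`_m
          = \sum_(i < n) (c i)%:C%C * (e i)`_m.
    by rewrite coef_sum; apply: eq_bigr => i _; exact: coefZ.
  rewrite (big_morph _ (@ReD R) (erefl _)).
  by apply: eq_bigr => i _; rewrite ReZ ReE.
have ImcE n (c : 'I_n -> R) m :
    complex.Im (\sum_(i < n) c i *: e i : cpoly R)`_m = \sum_(i < n) c i * (val i == m.*2.+1)%:R.
  have -> : (\sum_(i < n) c i *: e i : cpoly R)`_m
          = \sum_(i < n) (c i)%:C%C * (e i)`_m.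
    by rewrite coef_sum; apply: eq_bigr => i _; exact: coefZ.
  rewrite (big_morph _ (@ImD R) (erefl _)).
  by apply: eq_bigr => i _; rewrite ImZ ImE.
have pick n (c : 'I_n -> R) (i : 'I_n) k : val i = k ->
    \sum_(j < n) c j * (val j == k)%:R = c i.
  move=> ik; rewrite (bigD1 i) //= ik eqxx mulr1 big1 ?addr0 // => j ji.
  by rewrite -ik (inj_eq val_inj) (negPf ji) mulr0.
exists e; split=> [n c c0 i|u].
  have [oi|ei] := boolP (odd i).
    rewrite -(pick _ c i (i./2).*2.+1); last first.
      by rewrite -[LHS](odd_double_half i) oi add1n.
    by rewrite -ImcE c0 coef0.
  rewrite -(pick _ c i (i./2).*2); last first.
    by rewrite -[LHS](odd_double_half i) (negPf ei) add0n.
  by rewrite -RecE c0 coef0.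
exists (size u).*2, (fun k => if odd k then complex.Im u`_(k./2) else complex.Re u`_(k./2)).
apply/polyP=> m; apply/eqP; rewrite eq_complex RecE ImcE.
have [lem|ltm] := leqP (size u) m.
  rewrite nth_default // !big1 ?eqxx // => i _.
    by rewrite ltn_eqF ?mulr0 // ltnS ltnW // (leq_trans (ltn_ord i)) // leq_double.
  by rewrite ltn_eqF ?mulr0 // (leq_trans (ltn_ord i)) // leq_double.
have lt1 : (m.*2.+1 < (size u).*2)%N by rewrite ltn_Sdouble.
have lt0 : (m.*2 < (size u).*2)%N by rewrite ltn_double.
rewrite (pick _ _ (Ordinal lt1) m.*2.+1) // (pick _ _ (Ordinal lt0) m.*2) //=.
by rewrite odd_double /= doubleK uphalf_double !eqxx.
Qed.

End CountableDimension.

(** * Characters of a cyclic group, indexed by the integers *)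

Section Characters.
Local Open Scope ring_scope.
Variables (R : realType) (gT : finGroupType) (w : gT -> R[i]%C).
Hypotheses (w1 : w 1%g = 1) (wM : {morph w : x y / (x * y)%g >-> x * y}).

Definition chi (x : int) (g : gT) : R[i]%C := w g ^ x.

Lemma faithful_neq0 g : w g != 0.
Proof.
by apply/eqP=> wg0; have /eqP := w1; rewrite -(mulgV g) wM wg0 mul0r eq_sym oner_eq0.
Qed.

Lemma faithfulX g n : w (g ^+ n)%g = w g ^+ n.
Proof. by elim: n => [|n IHn]; rewrite ?expg0 ?w1 // expgS wM IHn exprS. Qed.

Lemma chi_neq0 x g : chi x g != 0.
Proof. by rewrite expfz_neq0 // faithful_neq0. Qed.

Lemma chi0 g : chi 0 g = 1. Proof. exact: expr0z. Qed.

Lemma chi1 x : chi x 1%g = 1. Proof. by rewrite /chi w1 exp1rz. Qed.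

Lemma chiM x g h : chi x (g * h)%g = chi x g * chi x h.
Proof. by rewrite /chi wM expfzMl. Qed.

Lemma chiD x y g : chi (x + y) g = chi x g * chi y g.
Proof. by rewrite /chi expfzDr // faithful_neq0. Qed.

Lemma chiN x g : chi (- x) g = (chi x g)^-1.
Proof. by rewrite /chi -invr_expz. Qed.

Lemma chiV x g : chi x g^-1%g = (chi x g)^-1.
Proof. by apply: (mulfI (chi_neq0 x g)); rewrite -chiM mulgV chi1 mulfV ?chi_neq0. Qed.

Lemma chi_conj x g : (chi x g)^* = (chi x g)^-1.
Proof.
have norm1 : `|chi x g| = 1.
  apply/eqP; rewrite -(@pexpr_eq1 _ _ #[g]%g) ?order_gt0 //.
  rewrite -normrX /chi exprnP exprz_exp mulrC -exprz_exp -exprnP.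
  by rewrite -faithfulX expg_order w1 exp1rz normr1.
by rewrite invC_norm norm1 expr1n invr1 mul1r.
Qed.

Hypothesis w_inj : injective w.

(** Orthogonality in the dual group, which 0, ..., |G| - 1 enumerate; a
    geometric sum. *)
Lemma chi_orth g :
  \sum_(y < #|gT|) chi y%:Z g = if g == 1%g then #|gT|%:R else 0.
Proof.
have [->|g1] := eqVneq.
  under eq_bigr => y _ do rewrite chi1.
  by rewrite sumr_const card_ord.
have wg1 : w g - 1 != 0 by rewrite subr_eq0 -w1 (inj_eq w_inj).
apply: (mulfI wg1); rewrite mulr0 /chi -subrX1 -faithfulX.
by rewrite -cardsT expg_cardG ?inE // w1 subrr.
Qed.

(** The restrictions to H of the characters of G form a cyclic group of
    order |H|. *)
Lemma chi_res (H : {group gT}) x y : cyclic H ->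
  (forall h, h \in H -> chi x h = chi y h) <-> (x == y %[mod #|H|])%Z.
Proof.
move=> cH; rewrite eqz_mod_dvd.
have [m ->] : exists m, y = x - m by exists (x - y); rewrite opprB addrCA subrr addr0.
rewrite opprB addrCA subrr addr0; split=> [E|/dvdzP[q ->] h Hh].
  have [c Hc] := cyclicP cH.
  have cc : c \in H by rewrite Hc cycle_id.
  have : chi m c = 1.
    have := E c cc; rewrite chiD chiN => Em; apply/eqP.
    rewrite -invr_eq1; apply/eqP/(mulfI (chi_neq0 x c)).
    by rewrite mulr1 -Em.
  have {}E n : chi n%:Z c = 1 -> (#|H| %| n)%N.
    rewrite /chi -exprnP -faithfulX -w1 => /w_inj /eqP.
    by rewrite -order_dvdn Hc.
  case: m => n; first exact: E.
  rewrite NegzE chiN => /eqP; rewrite invr_eq1 => /eqP/E.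
  by rewrite dvdzE.
rewrite chiD chiN mulrC [chi (q * _) h](_ : _ = 1) ?invr1 ?mul1r //.
rewrite /chi mulrC -exprz_exp -exprnP -faithfulX.
by rewrite expg_cardG // w1 exp1rz.
Qed.

End Characters.

(** * The universe with a given set of weights *)

Section WeightUniverse.
Local Open Scope ring_scope.
Variables (R : realType) (gT : finGroupType) (w : gT -> R[i]%C).
Hypotheses (w1 : w 1%g = 1) (wM : {morph w : x y / (x * y)%g >-> x * y}).
Variable S : pred int.
Hypothesis S0 : S 0.

(** The weights of the successive basis vectors: an enumeration of S in which
    every element occurs infinitely often. *)
Definition weight (n : nat) : int :=
  if (unpickle n : option (int * nat)) is Some (a, _) then
    if S a then a else 0
  else 0.

Definition weight_code (a : int) (m : nat) : nat := pickle (a, m).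

Lemma weight_in n : S (weight n).
Proof. by rewrite /weight; case: unpickle => [[a m]|] //; case: ifP. Qed.

Lemma weight_codeK a m : S a -> weight (weight_code a m) = a.
Proof. by rewrite /weight /weight_code pickleK => ->. Qed.

Lemma weight_code_inj a b m n : weight_code a m = weight_code b n -> m = n.
Proof. by move=> /(pcan_inj pickleK)[_ ->]. Qed.

Definition weight_fun (p : cpoly R) g : cpoly R :=
  \poly_(i < size p) (chi w (weight i) g * p`_i).

Lemma coef_weight_fun p g i : (weight_fun p g)`_i = chi w (weight i) g * p`_i.
Proof.
rewrite coef_poly; case: ltnP => // le; rewrite nth_default //.
by rewrite mulr0.
Qed.

Fact weight_is_action : is_action [set: gT] weight_fun.
Proof.
split=> [g p q /polyP pq|p g h _ _]; apply/polyP=> i.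
  by have := pq i; rewrite !coef_weight_fun; apply: mulfI; exact: chi_neq0.
by rewrite !coef_weight_fun mulrA chiM // [_ g * _]mulrC.
Qed.

Definition weight_act : {action gT &-> cpoly R} := Action weight_is_action.

Fact weight_linear g : linear (weight_act^~ g).
Proof.
move=> a p q; apply/polyP=> i; rewrite coefD [RHS]addrC.
have cs (b : R) (r : cpoly R) : (b *: r : cpoly R)`_i = b%:C%C * r`_i by exact: coefZ.
by rewrite cs !coef_weight_fun coefD cs mulrDr mulrCA addrC.
Qed.

Lemma hdot_weight p q g : hdot (weight_act p g) (weight_act q g) = hdot p q.
Proof.
rewrite [RHS](hdotE _ (leqnn _)) (hdotE (M := size p)) ?size_poly //.
apply: eq_bigr => i _; rewrite !coef_weight_fun rmorphM /= chi_conj //.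
by rewrite mulrACA mulfV ?mul1r // chi_neq0.
Qed.

(** Moving basis vectors to positions whose weights are all shifted by the same
    character is equivariant up to that character. *)
Lemma reindex_weight (c : R[i]%C) phi p g : injective phi ->
  (forall i, chi w (weight (phi i)) g = c * chi w (weight i) g) ->
  weight_act (reindex_poly phi p) g = c *: reindex_poly phi (weight_act p g).
Proof.
move=> phi_inj phiE; apply/polyP=> n; rewrite coef_weight_fun coefZ.
rewrite (reindex_polyE _ (leqnn (size p))) (@reindex_polyE _ _ (size p)) ?size_poly //.
rewrite !coef_sum !mulr_sumr; apply: eq_bigr => i _.
rewrite !coefZ coefXn coef_weight_fun; case: eqP => [->|_]; last by rewrite !mulr0.
by rewrite !mulr1 phiE mulrA.
Qed.

(** Every basis vector has infinitely many others of the same weight, so the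
    whole universe embeds into itself infinitely often. *)
Fact weight_rep V : fin_dim_subrep weight_act V ->
  contains_infinitely_often (@rdot R) weight_act V.
Proof.
(* the m-th embedding moves basis vector n to the one coded by its weight and
   the pair (m, n) *)
move=> _; pose phi (m n : nat) := weight_code (weight n) (pickle (m, n)).
have phi_inj m : injective (phi m).
  by move=> i j; rewrite /phi => /weight_code_inj/(pcan_inj pickleK)[].
exists (fun m => reindex_poly (phi m)); split=> [m a u v _ _|m u g _|m u v _ _|m n u v mn _ _].
- exact: reindex_polyP.
- rewrite [RHS](@reindex_weight 1) ?scale1r // => i.
  by rewrite weight_codeK ?mul1r // weight_in.
- by congr complex.Re; exact: hdot_reindex.
- rewrite /= /rdot hdot_reindex_disjoint // => i j; apply: contra_neqN mn => /eqP; rewrite /phi.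
  by move=> /weight_code_inj/(pcan_inj pickleK)[-> _].
Qed.

Fact weight_trivial : exists2 u : cpoly R, u != 0 & forall g, weight_act u g = u.
Proof.
exists 'X^(weight_code 0 0); first by rewrite -size_poly_eq0 size_polyXn.
move=> g; apply/polyP=> i; rewrite coef_weight_fun coefXn.
case: eqP => [->|_]; last by rewrite mulr0.
by rewrite weight_codeK // chi0 mul1r.
Qed.

Fact weight_isometric u v g : rdot (weight_act u g) (weight_act v g) = rdot u v.
Proof. by congr complex.Re; exact: hdot_weight. Qed.

Definition weight_universe : universe R gT :=
  @Universe R gT (cpoly R) (@rdot R) weight_act (@cpoly_countable_dim R)
    weight_linear weight_isometric weight_rep weight_trivial.

End WeightUniverse.

(** * Admissible sets of the universe with given weights *)

(** The reduction of S mod h is the full preimage of its reduction mod k, when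
    k divides h. *)
Definition weights_lift (S : pred int) (k h : nat) : Prop :=
  forall a x : int, S a -> (a == x %[mod k])%Z ->
    exists2 b : int, S b & (b == x %[mod h])%Z.

Section WeightAdmissible.
Local Open Scope ring_scope.
Variables (R : realType) (gT : finGroupType) (w : gT -> R[i]%C).
Hypotheses (w1 : w 1%g = 1) (wM : {morph w : x y / (x * y)%g >-> x * y}).
Hypothesis w_inj : injective w.
Hypothesis G_cyclic : cyclic [set: gT].
Variable S : pred int.
Hypothesis S0 : S 0.
Hypothesis SN : forall x, S (- x) = S x.

Local Notation C := R[i]%C.
Local Notation chi := (chi w).
Let U := weight_universe w1 wM S0.
Local Notation wact p g := (weight_fun w S p g : {poly C}).
Local Notation N := #|gT|.

Let subcyclic (H : {group gT}) : cyclic H := cyclicS (subsetT H) G_cyclic.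

Lemma weight_funD p q g : wact (p + q) g = wact p g + wact q g.
Proof.
by apply/polyP=> i; rewrite coefD !coef_weight_fun coefD mulrDr.
Qed.

Lemma weight_funZ a (p : {poly C}) g : wact (a *: p) g = a *: wact p g.
Proof.
by apply/polyP=> i; rewrite !(coefZ, coef_weight_fun) mulrCA.
Qed.

Lemma weight_fun0 g : wact 0 g = 0.
Proof. by apply/polyP=> i; rewrite coef_weight_fun !coef0 mulr0. Qed.

Lemma scalerAC (a b : C) (p : {poly C}) : a *: (b *: p) = b *: (a *: p).
Proof. by rewrite !scalerA mulrC. Qed.

Lemma conj_complexE (z : C) :
  z^* = (complex.Re z)%:C%C - 'i%C * (complex.Im z)%:C%C.
Proof.
case: z => r s; apply/eqP; rewrite eq_complex /=.
by rewrite !(mul0r, mul1r, oppr0, addr0, add0r, subr0) !eqxx.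
Qed.

Section Embedding.
Variables (H : {group gT}) (T : finType) (to : action H T).

(* The functions on T valued in U are decomposed as follows: for each point t
   and each character y of G, the Fourier sum F (t, y) u of the restriction of
   u to the orbit of t, normalized by c so that together these are isometric.
   Summing over all points rather than over representatives of the orbits, and
   over all characters of G rather than those of H trivial on the stabilizer,
   only adds redundancy: each orbit is counted once for each of its points, and
   the superfluous characters contribute 0. *)
Let c : C := (sqrtC (N * #|H|)%:R)^-1.

Let F (i : T * 'I_N) (u : {ffun T -> cpoly R}) : {poly C} :=
  c *: \sum_(g in H) chi i.2%:Z g *: (u (to i.1 g) : {poly C}).

Let FP i (a : R) (u v : {ffun T -> cpoly R}) :
  F i (a *: u + v) = a%:C%C *: F i u + F i v.
Proof.
rewrite /F scalerAC -scalerDr; congr (_ *: _).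
rewrite scaler_sumr -big_split; apply: eq_bigr => g _.
rewrite scalerAC /= -scalerDr; congr (_ *: _).
by rewrite !ffunE.
Qed.

Let cc : c * c^* = (N * #|H|)%:R^-1.
Proof.
have c_ge0 : 0 <= c by rewrite invr_ge0 sqrtC_ge0.
by rewrite -normCK ger0_norm // exprVn sqrtCK.
Qed.

Lemma chi_conjM y g h : chi y g * (chi y h)^* = chi y (g * h^-1)%g.
Proof. by rewrite chi_conj // chiM // chiV. Qed.

Let F_isometric u v : \sum_i hdot (F i u) (F i v) = \sum_t hdot (u t) (v t).
Proof.
have N0 : N%:R != 0 :> C by rewrite pnatr_eq0 -cardsT -lt0n cardG_gt0.
have H0 : #|H|%:R != 0 :> C by rewrite pnatr_eq0 -lt0n cardG_gt0.
rewrite -(pair_bigA _ (fun t y => hdot (F (t, y) u) (F (t, y) v))) /=.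
transitivity (\sum_t (#|H|%:R^-1 * \sum_(g in H) hdot (u (to t g)) (v (to t g)))).
  apply: eq_bigr => t _.
  transitivity (\sum_(y < N) (N * #|H|)%:R^-1 * \sum_(g in H) \sum_(h in H)
     chi y%:Z (g * h^-1)%g * hdot (u (to t g)) (v (to t h))).
    apply: eq_bigr => y _; rewrite /F hdotZl hdotZr mulrA cc; congr (_ * _).
    rewrite hdot_suml; apply: eq_bigr => g _.
    rewrite hdot_sumr; apply: eq_bigr => h _.
    by rewrite hdotZl hdotZr mulrA chi_conjM.
  rewrite -mulr_sumr natrM invfM [N%:R^-1 * _]mulrC -mulrA; congr (_ * _).
  apply: (mulfI N0); rewrite mulVKf // mulr_sumr exchange_big; apply: eq_bigr => g Hg.
  rewrite exchange_big (bigD1 g) //= -[X in X + _]mulr_suml.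
  rewrite (chi_orth w1 wM w_inj) mulgV eqxx big1 ?addr0 // => h /andP[_ hg].
  rewrite -mulr_suml (chi_orth w1 wM w_inj).
  by rewrite -eq_mulgV1 eq_sym (negPf hg) mul0r.
rewrite -mulr_sumr exchange_big /=.
have E g : \sum_t hdot (u (to t g)) (v (to t g)) = \sum_t hdot (u t) (v t).
  by rewrite [RHS](reindex_inj (act_inj to g)).
under eq_bigr => g _ do rewrite E.
by rewrite sumr_const -[X in _ * X]mulr_natl mulKf.
Qed.

Let F_equivariant i (u : {ffun T -> cpoly R}) h : h \in H ->
  F i [ffun t => wact (u (to t h)) h^-1%g]
    = chi i.2%:Z h^-1%g *: wact (F i u) h^-1%g.
Proof.
move=> Hh; rewrite /F weight_funZ [in RHS]scalerAC; congr (_ *: _).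
rewrite (big_morph (fun p => wact p h^-1%g) (fun p q => weight_funD p q _) (weight_fun0 _)).
rewrite scaler_sumr [RHS](reindex_inj (mulIg h)) /=.
apply: eq_big => g; first by rewrite groupMr.
move=> Hg; rewrite ffunE weight_funZ scalerA chiM // [chi _ g * _]mulrC mulrA.
by rewrite -chiM // mulVg chi1 // mul1r actMin.
Qed.

Let F_eq0 (i : T * 'I_N) u k : k \in 'C_H[i.1 | to]%g -> chi i.2%:Z k != 1 -> F i u = 0.
Proof.
rewrite in_stab => /andP[Hk /eqP tk] k1.
have : F i u = chi i.2%:Z k *: F i u.
  rewrite {2}/F scalerAC; congr (_ *: _); rewrite scaler_sumr.
  rewrite (reindex_inj (mulgI k)) /=.
  apply: eq_big => g; first by rewrite groupMl.
  by rewrite groupMl // => Hg; rewrite scalerA chiM // actMin // tk.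
move/eqP; rewrite -subr_eq0 -{1}[F i u]scale1r -scalerBl scaler_eq0 subr_eq0.
by rewrite eq_sym (negPf k1) => /eqP.
Qed.

(** The component of F (t, y) u on the basis vector n has to go to a vector whose
    weight restricts on H to the weight of n shifted by y.  The hypothesis
    provides such weights when y is trivial on the stabilizer of t; for other y
    the component vanishes and may be sent anywhere. *)
Lemma lift_admissible :
  (forall t, weights_lift S #|'C_H[t | to]%g| #|H|) -> admissible U to.
Proof.
move=> lift; apply/admissibleP.
(* b selects the new weight; it stays in S even when no such weight exists,
   so that weight_codeK always applies *)
have /choice[b bP] (iS : T * 'I_N * int) : exists b, S b /\
    (S iS.2 -> (forall k, k \in 'C_H[iS.1.1 | to]%g -> chi iS.1.2%:Z k = 1) ->
      forall h, h \in H -> chi b h = chi (iS.1.2%:Z + iS.2) h).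
  case: iS => [[t y] a] /=.
  have [Sa|nSa] := boolP (S a); last by exists 0; rewrite S0; split.
  case: (pselect (forall k, k \in 'C_H[t | to]%g -> chi y%:Z k = 1)) => triv; last first.
    by exists 0; split.
  have /lift : (a == y%:Z + a %[mod #|'C_H[t | to]%g|])%Z.
    apply/(chi_res w1 wM w_inj) => [|k Kk]; first exact: subcyclic.
    by rewrite chiD // triv // mul1r.
  case/(_ Sa)=> b Sb /(chi_res w1 wM w_inj b (y%:Z + a) (subcyclic H)) bE.
  by exists b; split.
pose phi (i : T * 'I_N) n := weight_code (b (i, weight S n)) (pickle (i, n)).
have phi_inj i : injective (phi i).
  by move=> m n; rewrite /phi => /weight_code_inj/(pcan_inj pickleK)[].
have wphi i n : weight S (phi i n) = b (i, weight S n).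
  by rewrite weight_codeK //; case: (bP (i, weight S n)).
exists (fun u => \sum_i reindex_poly (phi i) (F i u)); split=> [a u v|u v|h u Hh].
- apply: etrans (_ : \sum_i (a%:C%C *: reindex_poly (phi i) (F i u)
                              + reindex_poly (phi i) (F i v)) = _).
    by apply: eq_bigr => i _; rewrite FP reindex_polyP.
  by rewrite big_split /= -scaler_sumr.
- transitivity (complex.Re (\sum_t hdot (u t) (v t))); last first.
    exact: (big_morph _ (@ReD R) (erefl _)).
  rewrite -F_isometric; apply: (congr1 (@complex.Re R)); rewrite hdot_suml; apply: eq_bigr => i _.
  rewrite hdot_sumr (bigD1 i) //= hdot_reindex // big1 ?addr0 // => j ji.
  rewrite hdot_reindex_disjoint // => m n; apply: contra_neqN ji => /eqP.
  by rewrite /phi => /weight_code_inj/(pcan_inj pickleK)[-> _].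
- apply: etrans (_ : \sum_i wact (reindex_poly (phi i) (F i u)) h^-1%g = _); last first.
    by rewrite -(big_morph (fun p => wact p h^-1%g) (fun p q => weight_funD p q _) (weight_fun0 _)).
  apply: eq_bigr => i _; rewrite F_equivariant //.
  case: (pselect (forall k, k \in 'C_H[i.1 | to]%g -> chi i.2%:Z k = 1)) => triv.
    rewrite reindex_polyZ [RHS](reindex_weight w1 wM (c := chi i.2%:Z h^-1%g) (S := S)) // => n.
    rewrite wphi; case: (bP (i, weight S n)) => _ /= bE.
    by rewrite bE ?chiD ?groupV ?weight_in.
  have [k Kk k1] : exists2 k, k \in 'C_H[i.1 | to]%g & chi i.2%:Z k != 1.
    apply: contrapT => nex; apply: triv => k Kk; apply/eqP; apply: contrapT => k1.
    by apply: nex; exists k; last exact/negP.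
  by rewrite (F_eq0 _ Kk k1) weight_fun0 scaler0 reindex_poly0 weight_fun0.
Qed.

Section Eigenvector.
Variables (t0 : T) (a x : int).
Hypothesis ax : forall k, k \in 'C_H[t0 | to]%g -> chi a k = chi x k.
Hypothesis Sa : S a.

(* V z is the multiple by z of an eigenvector of weight x, supported on the
   orbit of t0, in the space of functions on T; it exists because a and x agree
   on the stabilizer of t0. *)
Let V (z : C) : {ffun T -> cpoly R} :=
  [ffun t => (z * \sum_(g in H | to t0 g == t) chi (a - x) g) *: 'X^(weight_code a 0)].

Let V_lin (z : C) : V z = complex.Re z *: V 1 + complex.Im z *: V 'i%C.
Proof.
apply/ffunP=> t; rewrite !ffunE; set s := \sum_(_ in _ | _) _; set m : {poly C} := 'X^_.
transitivity ((complex.Re z)%:C%C *: ((1 * s) *: m) + (complex.Im z)%:C%C *: (('i%C * s) *: m)).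
  rewrite !scalerA -scalerDl; apply: (congr1 (fun r : C => r *: m)).
  by rewrite {1}[z]complexE; ring.
by [].
Qed.

Let V_fixed z h : h \in H ->
  [ffun t => wact (V z (to t h)) h^-1%g] = V (chi x h^-1%g * z) :> {ffun T -> cpoly R}.
Proof.
move=> Hh; apply/ffunP=> t; rewrite !ffunE weight_funZ.
have -> : wact 'X^(weight_code a 0) h^-1%g = chi a h^-1%g *: 'X^(weight_code a 0).
  apply/polyP=> i; rewrite coef_weight_fun coefZ coefXn.
  by case: eqP => [->|_]; rewrite ?mulr0 // weight_codeK.
rewrite scalerA; apply: (congr1 (fun r : C => r *: ('X^(weight_code a 0) : {poly C}))).
suff E : (\sum_(g in H | to t0 g == to t h) chi (a - x) g) * chi a h^-1%g
       = chi x h^-1%g * \sum_(g in H | to t0 g == t) chi (a - x) g.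
  by rewrite -[LHS]mulrA E mulrCA mulrA.
rewrite (reindex_inj (mulIg h)) mulr_suml mulr_sumr; apply: eq_big => g /=.
  have [Hg|nHg] := boolP (g \in H); last by rewrite groupMr // (negPf nHg).
  by rewrite groupMr // Hg actMin // (inj_eq (act_inj to h)).
move=> _; rewrite chiM // -mulrA mulrC; congr (_ * _).
by rewrite chiD // chiN // !chiV // mulrAC mulfV ?mul1r ?chi_neq0.
Qed.

Let V_neq0 : V 1 t0 != 0.
Proof.
apply/eqP=> /polyP/(_ (weight_code a 0)).
rewrite ffunE coefZ coefXn eqxx mulr1 mul1r coef0.
rewrite (eq_bigr (fun=> 1)) => [|g /andP[Hg tg]]; last first.
  by rewrite chiD // chiN // ax ?mulfV ?chi_neq0 // in_stab Hg.
rewrite sumr_const => /eqP; rewrite pnatr_eq0 => /eqP/card0_eq/(_ 1%g).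
by rewrite unfold_in /= group1 act1 eqxx.
Qed.

(** The equivariant map f is only linear over the reals, so the image of an
    eigenvector V 1 need not be one.  But with A := f (V 1) and B := f (V i),
    the vectors A - iB and A + iB are eigenvectors of weights x and - x, and
    they are not both 0 as A is not.  This is where S = - S is needed. *)
Lemma admissible_eigenweight :
  admissible U to -> exists2 b : int, S b & (b == x %[mod #|H|])%Z.
Proof.
case/admissibleP=> f [f_lin f_iso f_fix].
pose A : {poly C} := f (V 1); pose B : {poly C} := f (V 'i%C).
have f0 : f 0 = 0 :> {poly C}.
  by have := f_lin (-1) 0 0; rewrite scaler0 addr0 scaleN1r addNr.
have fZ (r s : R) : f (r *: V 1 + s *: V 'i%C) = r%:C%C *: A + s%:C%C *: B :> {poly C}.
  apply: etrans (f_lin r (V 1) (s *: V 'i%C)) _; congr (_ + _).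
  apply: etrans (_ : f (s *: V 'i%C + 0) = _); first by rewrite addr0.
  apply: etrans (f_lin s (V 'i%C) 0) _.
  by apply: etrans (congr1 (+%R _) f0) _; apply: addr0.
have eigen (D : {poly C}) (y : int) : D != 0 ->
    (forall h, h \in H -> wact D h^-1%g = chi y h^-1%g *: D) ->
    exists n, (weight S n == y %[mod #|H|])%Z.
  move=> D0 DE; exists (size D).-1.
  apply/(chi_res w1 wM w_inj _ _ (subcyclic H)) => h Hh.
  have /polyP/(_ (size D).-1) := DE h^-1%g (groupVr Hh).
  rewrite invgK coef_weight_fun coefZ -lead_coefE; apply: mulIf.
  by rewrite lead_coef_eq0.
have AE h : h \in H -> let g := chi x h^-1%g in
    wact A h^-1%g = (complex.Re g)%:C%C *: A + (complex.Im g)%:C%C *: B.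
  move=> Hh /=; apply: etrans (esym (f_fix h (V 1) Hh)) _.
  by apply: etrans (congr1 f (V_fixed 1 Hh)) _; rewrite mulr1 V_lin fZ.
have BE h : h \in H -> let g := chi x h^-1%g in
    wact B h^-1%g = (- (complex.Im g)%:C%C) *: A + (complex.Re g)%:C%C *: B.
  move=> Hh /=; apply: etrans (esym (f_fix h (V 'i%C) Hh)) _.
  apply: etrans (congr1 f (V_fixed 'i%C Hh)) _.
  by rewrite V_lin fZ ReiNIm ImiRe rmorphN.
have i2 : 'i%C * 'i%C = -1 :> C by rewrite -expr2 sqr_i.
have Dm h : h \in H ->
    wact (A + (- 'i%C) *: B) h^-1%g = chi x h^-1%g *: (A + (- 'i%C) *: B).
  move=> Hh; rewrite weight_funD weight_funZ AE // BE // [in RHS](complexE (chi _ _)).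
  by apply/polyP=> k; rewrite !(coefD, coefZ); ring: i2.
have Dp h : h \in H ->
    wact (A + 'i%C *: B) h^-1%g = chi (- x) h^-1%g *: (A + 'i%C *: B).
  move=> Hh; rewrite weight_funD weight_funZ AE // BE // chiN // -chi_conj // conj_complexE.
  by apply/polyP=> k; rewrite !(coefD, coefZ); ring: i2.
have [D0|D0] := eqVneq (A + (- 'i%C) *: B) 0; last first.
  by have [n nx] := eigen _ x D0 Dm; exists (weight S n); rewrite ?weight_in.
have [D1|D1] := eqVneq (A + 'i%C *: B) 0; last first.
  have [n nx] := eigen _ (- x) D1 Dp.
  exists (- weight S n); first by rewrite SN weight_in.
  rewrite eqz_mod_dvd; rewrite eqz_mod_dvd in nx.
  have -> : - weight S n - x = - (weight S n - - x) by ring.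
  by rewrite rpredN; exact: nx.
have A0 : A = 0.
  have : A + A = 0.
    by rewrite -[RHS](addr0 0) -{1}D0 -D1 scaleNr addrACA addNr addr0.
  by rewrite -mulr2n -scaler_nat => /eqP; rewrite scaler_eq0 pnatr_eq0 => /eqP.
have ge0 (p : cpoly R) : 0 <= rdot p p.
  have [->|/rdot_gt0/ltW //] := eqVneq p 0.
  by rewrite /rdot hdot0l.
have : 0 < rdot (f (V 1)) (f (V 1)).
  rewrite [X in 0 < X](f_iso (V 1) (V 1)) (bigD1 t0) //=.
  by apply: ltr_pwDl; [apply: rdot_gt0; exact: V_neq0 | apply: sumr_ge0].
by rewrite -/A A0 /rdot hdot0l ltxx.
Qed.

End Eigenvector.

Theorem weight_admissible :
  admissible U to <-> forall t, weights_lift S #|'C_H[t | to]%g| #|H|.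
Proof.
split=> [adm t a x Sa|]; last exact: lift_admissible.
move/(chi_res w1 wM w_inj _ _ (subcyclic 'C_H[t | to]%G)) => ax.
exact: admissible_eigenweight ax Sa adm.
Qed.

End Embedding.
End WeightAdmissible.

(** * Realizing a saturated relation between divisors by weights *)

(** The properties of the relation H/K in I(H), transported to the orders k and
    h of K and H.  The last one is restriction of H/K to a subgroup that meets K
    trivially. *)
Record saturated_transfer (N : nat) (r : nat -> nat -> Prop) : Prop := SaturatedTransfer {
  st_refl : forall d, d %| N -> r d d;
  st_trans : forall k l h, k %| l -> l %| h -> h %| N -> r k l -> r l h -> r k h;
  st_sat : forall k l h, k %| l -> l %| h -> h %| N -> r k h -> r k l /\ r l h;
  st_res : forall k l, coprime k l -> k * l %| N -> r k (k * l) -> r 1 l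
}.

(** By transitivity and saturation, k -> h holds exactly when all the edges of
    some chain of prime steps from k to h hold. *)
Lemma saturated_transfer_agree N r1 r2 :
    0 < N -> saturated_transfer N r1 -> saturated_transfer N r2 ->
    (forall d l, prime l -> d * l %| N -> r1 d (d * l) <-> r2 d (d * l)) ->
  forall k h, k %| h -> h %| N -> r1 k h <-> r2 k h.
Proof.
move=> N0 st1 st2 edge k h kh hN; have h0 : 0 < h := dvdn_gt0 N0 hN.
have k0 : 0 < k := dvdn_gt0 h0 kh.
move: {2}(h %/ k) (leqnn (h %/ k)) => m; elim: m => [|m IHm] in k kh k0 *.
  by rewrite leqn0 -leqn0 leqNgt divn_gt0 // dvdn_leq.
have [d1|d1 lem] := leqP (h %/ k) 1.
  have -> : h = k.
    have q0 : 0 < h %/ k by rewrite divn_gt0 // dvdn_leq.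
    by rewrite -(divnK kh) (_ : h %/ k = 1) ?mul1n //; apply/eqP; rewrite eqn_leq d1.
  move=> _; have kN := dvdn_trans kh hN.
  by split=> _; apply: st_refl kN.
have [l [pl ld]] : exists l, prime l /\ l %| h %/ k by exists (pdiv (h %/ k)); rewrite pdiv_prime ?pdiv_dvd.
have klh : k * l %| h by rewrite -(divnK kh) mulnC dvdn_pmul2r.
have kkl : k %| k * l := dvdn_mulr _ (dvdnn k).
have IH : r1 (k * l) h <-> r2 (k * l) h.
  apply: IHm => //; first by rewrite muln_gt0 k0 prime_gt0.
  by rewrite -ltnS (leq_trans _ lem) // divnMA ltn_Pdiv ?prime_gt1 //; lia.
have E := edge k l pl (dvdn_trans klh hN).
split=> rkh.
  have [rl rr] := st_sat st1 kkl klh hN rkh.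
  by apply: (st_trans st2 kkl klh hN); [apply/E | apply/IH].
have [rl rr] := st_sat st2 kkl klh hN rkh.
by apply: (st_trans st1 kkl klh hN); [apply/E | apply/IH].
Qed.

Lemma eqz_mod_dvdn (a x : int) (k h : nat) :
  k %| h -> (a == x %[mod h])%Z -> (a == x %[mod k])%Z.
Proof. by move=> kh; rewrite !eqz_mod_dvd; apply: dvdz_trans; rewrite dvdzE. Qed.

Lemma lift_saturated S N : saturated_transfer N (weights_lift S).
Proof.
split=> [d _|k l h kl lh _ rkl rlh|k l h kl lh _ rkh|k l cop _ rk].
- by move=> a x Sa ax; exists a.
- by move=> a x Sa /(rkl a x Sa)[b Sb] /(rlh b x Sb).
- split=> a x Sa ax; last by apply: (rkh a x Sa); apply: eqz_mod_dvdn ax.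
  by have [b Sb bx] := rkh a x Sa ax; exists b => //; apply: eqz_mod_dvdn bx.
(* any a in S and any x are congruent to a common integer mod k and mod l *)
move=> a x Sa _.
have copz : coprimez k l by [].
have [|b Sb] := rk a (zchinese k l a x) Sa.
  by apply/eqP; rewrite zchinese_modl.
move/(eqz_mod_dvdn (dvdn_mull _ (dvdnn l))) => bx; exists b => //.
by rewrite (eqP bx); apply/eqP; rewrite zchinese_modr.
Qed.

Section PrimePower.
Local Open Scope ring_scope.
Variables (p : nat) (E : pred nat).
Hypothesis p_prime : prime p.

Definition valuation_weights : pred int :=
  fun x => (x == 0) || E (logn p `|x|%N).

Lemma valuationP (x : int) (l : nat) :
  ((p ^ l)%N %| x)%Z -> ~~ ((p ^ l.+1)%N %| x)%Z -> x != 0 /\ logn p `|x|%N = l.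
Proof.
move=> xl; have [->|x0] := eqVneq x 0; first by rewrite dvdz0.
rewrite !dvdzE /= in xl *; rewrite pfactor_dvdn ?absz_gt0 // -ltnNge => lt.
rewrite pfactor_dvdn ?absz_gt0 // in xl.
by split=> //; apply/eqP; rewrite eqn_leq xl -ltnS lt.
Qed.

(** Multiples of p^(i+1) lift to 0, and the integers of valuation less than i
    are in S as soon as an element of their class mod p^i is; so the edge
    depends on the integers of valuation i only. *)
Lemma valuation_lift i :
  weights_lift valuation_weights (p ^ i) (p ^ i.+1) <-> E i.
Proof.
have dvd_mod (a x : int) (n m : nat) : (n <= m)%N -> (a == x %[mod (p ^ m)%N])%Z ->
    ((p ^ n)%N %| a)%Z = ((p ^ n)%N %| x)%Z.
  move=> nm; rewrite eqz_mod_dvd => ax.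
  have {}ax : ((p ^ n)%N %| a - x)%Z.
    by apply: dvdz_trans ax; rewrite dvdzE dvdn_exp2l.
  by rewrite -[a](subrK x) rpredDl.
split=> [lift|Ei a x Sa ax].
  have [||b] := lift 0 (p ^ i)%N.
  - by rewrite /valuation_weights eqxx.
  - by rewrite eqz_mod_dvd sub0r rpredN dvdzz.
  rewrite /valuation_weights => Sb bx.
  have bi : ((p ^ i)%N %| b)%Z by rewrite (dvd_mod _ _ _ _ (leqnSn i) bx) dvdzz.
  have nbi : ~~ ((p ^ i.+1)%N %| b)%Z.
    by rewrite (dvd_mod _ _ _ _ (leqnn _) bx) dvdzE /= dvdn_Pexp2l ?prime_gt1 // ltnn.
  have [b0 bl] := valuationP bi nbi.
  by rewrite (negPf b0) bl in Sb.
have [xi1|nxi1] := boolP ((p ^ i.+1)%N %| x)%Z.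
  exists 0; first by rewrite /valuation_weights eqxx.
  by rewrite eqz_mod_dvd sub0r rpredN.
exists x => //; have [xi|nxi] := boolP ((p ^ i)%N %| x)%Z.
  by have [_ xl] := valuationP xi nxi1; rewrite /valuation_weights xl Ei orbT.
have x0 : x != 0 by apply: contraNneq nxi => ->; rewrite dvdz0.
have li : (logn p `|x|%N < i)%N.
  by rewrite ltnNge -pfactor_dvdn ?absz_gt0 // -[X in (X %| _)%N]/(`|(p ^ i)%N%:Z|%N) -dvdzE.
have vx m : ((p ^ m)%N %| x)%Z = (m <= logn p `|x|%N)%N.
  by rewrite dvdzE /= pfactor_dvdn ?absz_gt0.
have [||na0 al] := @valuationP a (logn p `|x|%N).
- by rewrite (dvd_mod _ _ _ _ (ltnW li) ax) vx.
- by rewrite (dvd_mod _ _ _ _ li ax) vx ltnn.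
by move: Sa; rewrite /valuation_weights (negPf na0) (negPf x0) al.
Qed.

End PrimePower.

Section TwoPrimes.
Local Open Scope ring_scope.
Variables (p q : nat) (S : pred int).

Lemma lift_multiples : coprime p q -> (forall x, (q %| x)%Z -> S x) ->
  weights_lift S 1 p.
Proof.
move=> cop Sq a x _ _; have copz : coprimez p q by [].
exists (zchinese p q x 0); last by apply/eqP; rewrite zchinese_modl.
by apply: Sq; rewrite -[X in (_ %| X)%Z]subr0 -eqz_mod_dvd; apply/eqP; rewrite zchinese_modr.
Qed.

(** The class of 2 mod q is not in {0, 1, -1}, because q > 3. *)
Lemma not_lift_sparse : (3 < q)%N -> S 0 ->
  (forall x, S x -> [|| (q %| x)%Z, x == 1 | x == -1]) -> ~ weights_lift S 1 q.
Proof.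
move=> q3 S0 Sq /(_ 0 2 S0)[|b /Sq]; first by rewrite eqz_mod_dvd dvdzE.
case/or3P=> [qb|/eqP->|/eqP->].
- rewrite eqz_mod_dvd rpredDl // rpredN dvdzE => /(dvdn_leq (isT : 0 < 2)%N) /=; lia.
- rewrite eqz_mod_dvd dvdzE => /(dvdn_leq (isT : 0 < 1)%N) /=; lia.
- rewrite eqz_mod_dvd dvdzE => /(dvdn_leq (isT : 0 < 3)%N) /=; lia.
Qed.

End TwoPrimes.

(** In the square 1, p, q, pq, restriction forces the edge opposite to p -> pq
    and saturation forces q -> pq once 1 -> pq holds. *)
Lemma square_rules p q (r : nat -> nat -> Prop) :
    coprime p q -> saturated_transfer (p * q) r ->
  [/\ r p (p * q) -> r 1 q, r q (p * q) -> r 1 p,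
      r 1 p -> r p (p * q) -> r q (p * q)
    & r 1 q -> r q (p * q) -> r p (p * q)].
Proof.
move=> cop st; have R1 := st_res st cop (dvdnn _).
have cop' : coprime q p by rewrite coprime_sym.
have := st_res st cop'; rewrite mulnC dvdnn => /(_ isT) R2; split=> //.
  move=> h1 h2; apply: (st_sat st (dvd1n _) _ (dvdnn _) _).2; first exact: dvdn_mull.
  by apply: (st_trans st (dvd1n p) _ (dvdnn _) h1 h2); apply: dvdn_mulr.
move=> h1 h2; apply: (st_sat st (dvd1n _) _ (dvdnn _) _).2; first exact: dvdn_mulr.
by apply: (st_trans st (dvd1n q) _ (dvdnn _) h1 h2); apply: dvdn_mull.
Qed.

Lemma square_agree p q r r' :
    prime p -> prime q ->
    saturated_transfer (p * q) r -> saturated_transfer (p * q) r' ->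
    r 1 p <-> r' 1 p -> r 1 q <-> r' 1 q ->
    r p (p * q) <-> r' p (p * q) -> r q (p * q) <-> r' q (p * q) ->
  forall k h, k %| h -> h %| p * q -> r k h <-> r' k h.
Proof.
move=> pp pq st st' e1 e2 e3 e4.
apply: saturated_transfer_agree st st' _ => [|d l pl].
  by rewrite muln_gt0 !prime_gt0.
have pdiv1 m : prime m -> d %| m -> d = 1 \/ d = m.
  by move=> /primeP[_ dm] /dm/pred2P.
move=> dlN; have: l %| p * q := dvdn_trans (dvdn_mull _ (dvdnn l)) dlN.
rewrite Euclid_dvdM // !dvdn_prime2 // => /orP[]/eqP lE; move: dlN; rewrite lE.
  rewrite [p * q]mulnC dvdn_pmul2r ?prime_gt0 // => /(pdiv1 _ pq)[]->.
    by rewrite mul1n.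
  by rewrite mulnC.
by rewrite dvdn_pmul2r ?prime_gt0 // => /(pdiv1 _ pp)[]->; rewrite ?mul1n.
Qed.

(** The relations with 1 -> p but not 1 -> q; then p -> pq fails, and q -> pq can
    hold or not.  It holds for S = qZ.  Adding 1 and -1 breaks it, because
    1 + q is then congruent mod q, but not mod pq, to an element of S; the
    image of S in Z/q still misses 2. *)
Lemma one_edge_weights p q (b : bool) :
    coprime p q -> 1 < p -> 3 < q ->
  exists S : pred int, [/\ S 0%R, forall x, S (- x)%R = S x,
    weights_lift S 1 p, ~ weights_lift S 1 q & weights_lift S q (p * q) <-> b].
Proof.
move=> cop p1 q3; case: b.
  exists (fun x => (q %| x)%Z); split=> //.
  - exact: rpredN.
  - exact: (lift_multiples cop).
  - by apply: not_lift_sparse => // x ->.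
  - split=> // _ a x qa; rewrite eqz_mod_dvd => qax; exists x => //.
    by rewrite -[x](subrK a) rpredD // -opprB rpredN.
exists (fun x => [|| (q %| x)%Z, x == 1 | x == -1]%R); split=> //.
- by rewrite dvdz0.
- by move=> x; rewrite rpredN !eqr_oppLR opprK; congr (_ || _); exact: orbC.
- by apply: (lift_multiples cop) => x ->.
- by apply: not_lift_sparse; rewrite ?dvdz0.
split=> // /(_ 1 (1 + q%:Z))%R [].
- by rewrite eqxx orbT.
- by rewrite eqz_mod_dvd opprD addNKr rpredN.
move=> b Sb bx.
have qbx := eqz_mod_dvdn (dvdn_mull p (dvdnn q)) bx.
have pbx := eqz_mod_dvdn (dvdn_mulr q (dvdnn p)) bx.
case/or3P: Sb qbx pbx => [qb|/eqP->|/eqP->].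
- rewrite !eqz_mod_dvd rpredDl // rpredN rpredDr ?dvdzz // dvdzE dvdn1 => /eqP; lia.
- rewrite !eqz_mod_dvd opprD addNKr !rpredN => _; rewrite dvdzE /= => pq.
  by move: cop; rewrite /coprime (gcdn_idPl pq); lia.
- rewrite !eqz_mod_dvd opprD addrA rpredDr ?rpredN ?dvdzz //.
  rewrite dvdzE => /(dvdn_leq (isT : 0 < 2)) /=; lia.
Qed.

Lemma two_primes_weights p q (r : nat -> nat -> Prop) :
    prime p -> prime q -> p <> q -> 3 < p -> 3 < q ->
    saturated_transfer (p * q) r ->
  exists S : pred int, [/\ S 0%R, forall x, S (- x)%R = S x
    & forall k h, k %| h -> h %| p * q -> r k h <-> weights_lift S k h].
Proof.
move=> pp pq neq p3 q3 st.
have cop : coprime p q by rewrite prime_coprime // dvdn_prime2 //; apply/eqP.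
have cop' : coprime q p by rewrite coprime_sym.
have [rp1 rp2 rp3 rp4] := square_rules cop st.
have lS S := square_rules cop (lift_saturated S (p * q)).
have agree S := square_agree pp pq st (lift_saturated S (p * q)).
case: (pselect (r 1 p)) (pselect (r 1 q)) => [r1p|nr1p] [r1q|nr1q].
- case: (pselect (r p (p * q))) => [rp|nrp].
    exists predT; split=> //.
    have all k h : weights_lift predT k h by move=> a x _ _; exists x.
    by apply: agree; split=> // _; exact: rp3.
  have nrq : ~ r q (p * q) by move=> rq; apply/nrp/rp4.
  pose S : pred int := fun x => (p %| x)%Z || (q %| x)%Z.
  have [_ _ _ l4] := lS S.
  have Lp : weights_lift S 1 p.
    by apply: (lift_multiples cop) => x; rewrite /S => ->; rewrite orbT.
  have Lq : weights_lift S 1 q by apply: (lift_multiples cop') => x; rewrite /S => ->.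
  (* 1 is not congruent mod pq to a multiple of p or of q *)
  have nLN : ~ weights_lift S p (p * q).
    move=> L.
    have L1 := st_trans (lift_saturated S (p * q)) (dvd1n p)
                 (dvdn_mulr q (dvdnn p)) (dvdnn _) Lp L.
    have [||b Sb bx] := L1 0%R 1%R; rewrite /S ?dvdz0 ?eqz_mod_dvd ?dvd1z //.
    case/orP: Sb => [pb|qb].
      have := eqz_mod_dvdn (dvdn_mulr q (dvdnn p)) bx.
      rewrite eqz_mod_dvd rpredDl // rpredN dvdzE dvdn1 => /eqP; lia.
    have := eqz_mod_dvdn (dvdn_mull p (dvdnn q)) bx.
    rewrite eqz_mod_dvd rpredDl // rpredN dvdzE dvdn1 => /eqP; lia.
  exists S; split; [by rewrite /S dvdz0 | by move=> x; rewrite /S !rpredN |].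
  by apply: agree; split=> // L; exfalso; first [exact: nLN L | exact: nLN (l4 Lq L)].
- have [S [S0 SN Lp nLq e]] := one_edge_weights `[< r q (p * q) >] cop (ltnW (ltnW p3)) q3.
  have [l1 _ _ _] := lS S.
  exists S; split=> //; apply: agree; split=> //.
  + by move/rp1.
  + by move/l1.
  + by move=> ?; apply/e/asboolP.
  + by move=> ?; apply/asboolP/e.
- have [S [S0 SN Lp nLq e]] := one_edge_weights `[< r p (p * q) >] cop' (ltnW (ltnW q3)) p3.
  have [_ l2 _ _] := lS S.
  rewrite mulnC in e.
  exists S; split=> //; apply: agree; split=> //.
  + by move=> ?; apply/e/asboolP.
  + by move=> ?; apply/asboolP/e.
  + by move/rp2.
  + by move/l2.
- pose S : pred int := fun x => x == 0%R.
  have [l1 l2 _ _] := lS S.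
  have sparse m : 3 < m -> ~ weights_lift S 1 m.
    by move=> m3; apply: not_lift_sparse => // x; rewrite /S => /eqP->; rewrite dvdz0.
  have [np nq] := (sparse p p3, sparse q q3).
  exists S; split; [by rewrite /S | by move=> x; rewrite /S oppr_eq0 |].
  by apply: agree; split=> //; [move/rp1 | move/l1 | move/rp2 | move/l2].
Qed.

Lemma prime_power_weights p n (r : nat -> nat -> Prop) :
    prime p -> saturated_transfer (p ^ n) r ->
  exists S : pred int, [/\ S 0%R, forall x, S (- x)%R = S x
    & forall k h, k %| h -> h %| p ^ n -> r k h <-> weights_lift S k h].
Proof.
move=> pp st; pose E i := `[< r (p ^ i) (p ^ i.+1) >].
exists (valuation_weights p E); split=> [|x|].
- by rewrite /valuation_weights eqxx.
- by rewrite /valuation_weights oppr_eq0 abszN.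
apply: saturated_transfer_agree st (lift_saturated _ _) _; first by rewrite expn_gt0 prime_gt0.
move=> d l pl /(dvdn_pfactor _ _ pp)[m _ dlE].
have lp : l = p.
  apply/eqP; rewrite -(dvdn_prime2 pl pp).
  have: l %| p ^ m by rewrite -dlE dvdn_mull.
  by rewrite Euclid_dvdX // => /andP[].
case: m dlE => [|m].
  by rewrite expn0 => /eqP; rewrite muln_eq1 lp => /andP[_ /eqP p1]; rewrite p1 in pp.
rewrite lp expnSr => /eqP; rewrite eqn_pmul2r ?prime_gt0 // => /eqP->.
rewrite -expnSr; apply: iff_trans (iff_sym (valuation_lift E pp m)).
by split=> /asboolP.
Qed.

(** * The relation defined by an indexing system on a cyclic group *)

Section CyclicTransfers.
Variables (gT : finGroupType) (I : hset_class gT).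
Hypothesis G_cyclic : cyclic [set: gT].
Hypothesis I_ok : indexing_system I.
Implicit Types K L H : {group gT}.

(** A subgroup of a cyclic group is determined by its order, so the existential
    quantifiers describe at most one pair (K, H): see transferE. *)
Definition transfer (k h : nat) : Prop :=
  exists K H, [/\ K \subset H, #|K| = k, #|H| = h & I (coset_act H K)].

Lemma cyclic_sub K H : (K \subset H) = (#|K| %| #|H|).
Proof. by rewrite (cardSg_cyclic G_cyclic) ?subsetT. Qed.

Lemma cyclic_card_inj K H : #|K| = #|H| -> K = H.
Proof.
move=> KH; apply/val_inj/eqP; rewrite /= (eq_subG_cyclic G_cyclic) ?subsetT //.
exact/eqP.
Qed.

Lemma cyclic_subgroup d : d %| #|gT| -> exists H, #|H| = d.
Proof.
have [c Gc] := cyclicP G_cyclic; have oc : (#[c] = #|gT|)%g by rewrite /order -Gc cardsT.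
rewrite -oc => dN; exists <[(c ^+ (#[c]%g %/ d))%g]>%G.
have d0 : 0 < d := dvdn_gt0 (order_gt0 c) dN.
rewrite /= -/(order _) orderXdiv ?dvdn_div //.
by rewrite -{1}(divnK dN) mulKn // divn_gt0 // dvdn_leq ?order_gt0.
Qed.

Lemma transferE K H : K \subset H -> I (coset_act H K) <-> transfer #|K| #|H|.
Proof.
move=> sKH; split=> [IKH|[K' [H' [_ /cyclic_card_inj-> /cyclic_card_inj->]]] //].
by exists K, H.
Qed.

Lemma transfer_saturated :
  (forall K L H, K \subset L -> L \subset H -> I (coset_act H K) ->
     I (coset_act L K) /\ I (coset_act H L)) ->
  saturated_transfer #|gT| transfer.
Proof.
move=> sat.
have chain k l h : k %| l -> l %| h -> h %| #|gT| ->
    exists K L H, [/\ #|K| = k, #|L| = l, #|H| = h, K \subset L & L \subset H].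
  move=> kl lh hN; have [H Hh] := cyclic_subgroup hN.
  have [L Ll] := cyclic_subgroup (dvdn_trans lh hN).
  have [K Kk] := cyclic_subgroup (dvdn_trans kl (dvdn_trans lh hN)).
  by exists K, L, H; rewrite !cyclic_sub Kk Ll Hh.
split=> [d /cyclic_subgroup[H <-]|k l h kl lh hN|k l h kl lh hN|k l cop klN].
- by apply/transferE => //; exact: indexing_refl.
- have [K [L [H [<- <- <- sKL sLH]]]] := chain k l h kl lh hN.
  move=> /(transferE sKL) rKL /(transferE sLH) rLH.
  by apply/transferE; [exact: subset_trans sLH | exact: indexing_trans rLH].
- have [K [L [H [<- <- <- sKL sLH]]]] := chain k l h kl lh hN.
  move=> /(transferE (subset_trans sKL sLH)) /(sat _ _ _ sKL sLH)[rKL rLH].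
  by split; apply/transferE.
case=> K [H [sKH Kk Hkl rKH]].
have [L Ll] : exists L, #|L| = l by apply: cyclic_subgroup; apply: dvdn_trans klN; exact: dvdn_mull.
have sLH : L \subset H by rewrite cyclic_sub Ll Hkl dvdn_mull.
have KL1 : #|(L :&: K)%G| = 1.
  by rewrite /= setIC coprime_TIg ?cards1 // Kk Ll.
rewrite -KL1 -Ll; apply/transferE; first exact: subsetIl.
exact: (indexing_restr I_ok sLH rKH).
Qed.

End CyclicTransfers.

Theorem theorem5p17 (R : realType) (gT : finGroupType) (I : hset_class gT)
  (G_cyclic : cyclic [set: gT])
  (G_order : (exists p n : nat, prime p /\ #|gT| = (p ^ n)%N) \/
     (exists p q : nat, [/\ prime p, prime q, p <> q, (3 < p)%N /\ (3 < q)%N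
                          & #|gT| = (p * q)%N]))
  (I_indexing : indexing_system I) :
  (exists U : universe R gT,
     forall (H : {group gT}) (T : finType) (to : action H T),
       I H T to <-> admissible U to)
  <->
  (forall K L H : {group gT}, K \subset L -> L \subset H ->
     I H _ (coset_act H K) ->
     I L _ (coset_act L K) /\ I H _ (coset_act H L)).
Proof.
split=> [[U IU] K L H sKL sLH IHK|sat].
  split; last by apply/IU/(admissible_coset_overgroup sKL sLH)/IU.
  have := indexing_restr I_indexing sLH IHK.
  by have -> : (L :&: K)%G = K by apply/val_inj/setIidPr.
have st := transfer_saturated G_cyclic I_indexing sat.
have [S [S0 SN SE]] : exists S : pred int, [/\ S 0%R, forall x, S (- x)%R = S x
    & forall k h, k %| h -> h %| #|gT| -> transfer I k h <-> weights_lift S k h].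
  case: G_order => [[p [n [pp GE]]]|[p [q [pp pq neq [p3 q3] GE]]]]; rewrite GE in st *.
    exact: prime_power_weights.
  exact: two_primes_weights.
have [w [w1 wM w_inj]] := faithful_character R G_cyclic.
exists (weight_universe w1 wM S0) => H T to.
apply: iff_trans (indexing_orbits I_indexing to) _.
apply: iff_trans (iff_sym (weight_admissible w1 wM w_inj G_cyclic S0 SN to)).
have E t : I _ _ (coset_act H 'C_H[t | to]%G)
    <-> weights_lift S #|'C_H[t | to]%g| #|H|.
  have sK : 'C_H[t | to]%G \subset H := subsetIl _ _.
  apply: iff_trans (transferE I G_cyclic sK) _.
  apply: SE; first by rewrite cardSg ?subsetIl.
  by rewrite -cardsT cardSg ?subsetT.
by split=> h t; apply/E.
Qed.
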